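(* Let $\mathfrak{g}$ be a $2$-step nilpotent Lie algebra of genus $2$ over $\mathbb{R}$, whose associated pencil (with respect to some basis) has minimal indices $\varepsilon_1,\ldots,\varepsilon_k$ and pairs of elementary divisors \[ (\infty,e_1),\ldots,(\infty,e_s),\; (\alpha_1,f_1),\ldots,(\alpha_l,f_l),\; (\beta_1,m_1),\ldots,(\beta_p,m_p) \] with $\alpha_j\in\mathbb{R}$ and $\beta_r=a_r+b_r i\in\mathbb{C}\setminus\mathbb{R}$ for all $1\le j\le l$ and $1\le r\le p$. Then \[ \dim(\mathrm{AID}(\mathfrak{g}))=\dim(\mathrm{Inn}(\mathfrak{g}))+\sum_{j=1,\ \varepsilon_j\neq 0}^{k}(\varepsilon_j-1)+2\sum_{j=1}^{s}(e_j-1)+2\sum_{j=1}^{l}(f_j-1)+4\sum_{j=1}^{p}m_j. \]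
   Context: All Lie algebras are finite-dimensional. A Lie algebra $\mathfrak{g}$ over $\mathbb{R}$ is $2$-step nilpotent if $[\mathfrak{g},[\mathfrak{g},\mathfrak{g}]]=0$; a $2$-step nilpotent $\mathfrak{g}$ has genus $2$ if $\dim([\mathfrak{g},\mathfrak{g}])=2$. A derivation $D$ of $\mathfrak{g}$ is almost inner if $D(x)\in[\mathfrak{g},x]$ for all $x\in\mathfrak{g}$; $\mathrm{AID}(\mathfrak{g})$ is the space of almost inner derivations and $\mathrm{Inn}(\mathfrak{g})$ the space of inner derivations. Associated pencil: choose a basis $(x_1,\ldots,x_n,y_1,y_2)$ of $\mathfrak{g}$ with $(y_1,y_2)$ a basis of $[\mathfrak{g},\mathfrak{g}]$, and write $[x_i,x_j]=a_{ij}y_1+b_{ij}y_2$, $A=(a_{ij})$, $B=(b_{ij})$. The skew pencil associated to $\mathfrak{g}$ with respect to this basis is $\mu A+\lambda B\in M_n(\mathbb{R}[\lambda,\mu])$. Elementary divisors: let $r$ be the rank of $\mu A+\lambda B$ (over $\mathbb{R}(\lambda,\mu)$). For $1\le m\le r$ let $G_m(\mu,\lambda)$ be the greatest common divisor of all minors of order $m$ of $\mu A+\lambda B$, and put $i_1=G_1$, $i_m=G_m/G_{m-1}$ for $1<m\le r$ (the invariant factors). The elementary divisors are the prime power factors (up to scalars) occurring in the factorizations of $i_1,\ldots,i_r$ into powers of pairwise non-associate primes of $\mathbb{R}[\lambda,\mu]$, listed with multiplicity (over all $m$). For a skew pencil over $\mathbb{R}$ the elementary divisors occur in pairs: $(\infty,e)$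 denotes the pair $\mu^e,\mu^e$; $(\alpha,f)$ with $\alpha\in\mathbb{R}$ denotes the pair $(\lambda-\mu\alpha)^f,(\lambda-\mu\alpha)^f$; and $(\beta,m)$ with $\beta=a+bi\in\mathbb{C}\setminus\mathbb{R}$ denotes the pair $\xi(a,b)^m,\xi(a,b)^m$, where $\xi(a,b)=(\lambda-\mu(a+ib))(\lambda-\mu(a-ib))=\lambda^2-2a\lambda\mu+(a^2+b^2)\mu^2$. Here $e,f,m\ge 1$. The list in the claim is the complete list of these pairs (repetitions allowed, and the $\alpha_j$, resp. $\beta_r$, need not be distinct). Minimal indices: if $\mu A+\lambda B$ is singular (its determinant is the zero polynomial), choose a nonzero solution $x_1(\lambda)\in\mathbb{R}[\lambda]^n$ of $(A+\lambda B)x=0$ of minimal degree $\varepsilon_1$; then among solutions that are $\mathbb{R}[\lambda]$-linearly independent of $x_1(\lambda)$ choose $x_2(\lambda)$ of minimal degree $\varepsilon_2$; continue in this way (each new solution of minimal degree among those $\mathbb{R}[\lambda]$-independent of the previous ones) until a maximal $\mathbb{R}[\lambda]$-independent set $x_1(\lambda),\ldots,x_k(\lambda)$ of solutions is obtained. The degrees $\varepsilon_1\le\cdots\le\varepsilon_k$ do not depend on the choices and are the minimal indices. If the pencil is not singular, there are no minimal indices ($k=0$). *)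

(* Defs.v *)
From HB Require Import structures.
From mathcomp Require Import all_boot all_order all_algebra.
From mathcomp Require Import boolp classical_sets reals.
From mathcomp.real_closed Require Import complex.

Set Implicit Arguments.
Unset Strict Implicit.
Unset Printing Implicit Defensive.

Import Order.TTheory GRing.Theory Num.Theory.

Local Open Scope ring_scope.

HB.mixin Record Vector_isLie (K : fieldType) L of Vector K L := {
  lie : L -> L -> L;
  lie_linearl : forall y, linear (lie^~ y);
  lie_linearr : forall x, linear (lie x);
  liexx : forall x, lie x x = 0;
  lie_jacobi : forall x y z,
    lie x (lie y z) + lie y (lie z x) + lie z (lie x y) = 0
}.

#[short(type="lieAlgType")]
HB.structure Definition LieAlgebra (K : fieldType) :=
  { L of Vector_isLie K L & Vector K L }.

Section Subspaces.
Variables (K : fieldType) (V : vectType K).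

(* Dimensions are only available for {vspace V}; [subspace_of P] is the
   {vspace V} whose elements are those satisfying P (see [mem_subspace_of]),
   and 0 if P does not define a linear subspace. *)
Definition subspace_of (P : V -> Prop) : {vspace V} :=
  xget 0%VS [set U : {vspace V} | forall v, v \in U <-> P v]%classic.

Lemma mem_subspace_of (P : V -> Prop) :
    P 0 -> (forall a u v, P u -> P v -> P (a *: u + v)) ->
  forall v, v \in subspace_of P <-> P v.
Proof.
move=> P0 Plin.
pose Q d := `[< exists U : {vspace V}, \dim U = d /\ forall v, v \in U -> P v >].
have Q0 : exists d, Q d.
  exists 0%N; apply/asboolP; exists 0%VS; split; first exact: dimv0.
  by move=> v; rewrite memv0 => /eqP ->.
have Qmax d : Q d -> (d <= \dim {:V})%N.
  by move=> /asboolP[U [<- _]]; apply/dimvS/subvf.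
have [d /asboolP[U [dU UP]] dmax] := ex_maxnP Q0 Qmax.
apply: (@xgetPex _ 0%VS [set U : {vspace V} | forall v, v \in U <-> P v]%classic).
exists U => v; split; first exact: UP.
move=> Pv; have: Q (\dim (U + <[v]>)).
  apply/asboolP; exists (U + <[v]>)%VS; split=> // w /memv_addP[u Uu [v']].
  by move=> /vlineP[a ->] ->; rewrite addrC; apply: Plin => //; apply: UP.
move=> /dmax; rewrite -dU => dle.
have /eqP -> : U == (U + <[v]>)%VS by rewrite eqEdim addvSl dle.
by rewrite memvE addvSr.
Qed.

End Subspaces.

Section LieAlgebras.
Variables (K : fieldType) (g : lieAlgType K).
Implicit Types (U V W : {vspace g}) (D : 'End(g)).

Definition lie_flip (y x : g) : g := lie x y.

HB.instance Definition _ (x : g) :=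
  GRing.isLinear.Build K g g _ (lie x) (lie_linearr x).
HB.instance Definition _ (y : g) :=
  GRing.isLinear.Build K g g _ (lie_flip y) (lie_linearl y).

Lemma lie0l (x : g) : lie 0 x = 0. Proof. exact: (linear0 (lie_flip x)). Qed.

Lemma lie0r (x : g) : lie x 0 = 0. Proof. exact: linear0. Qed.

Definition lie_prodv U V : {vspace g} :=
  <<[seq lie u v | u <- vbasis U, v <- vbasis V]>>%VS.

Lemma lie_prodvP U V W :
  reflect {in U & V, forall u v, lie u v \in W} (lie_prodv U V <= W)%VS.
Proof.
apply: (iffP idP) => [sW u v Uu Vv | UVW]; last first.
  apply/span_subvP => _ /allpairsP[[u v] /= [uU vV ->]].
  by apply: UVW; apply: vbasis_mem.
apply: (subvP sW); rewrite (coord_vbasis Uu) -[lie _ _]/(lie_flip v _) linear_sum.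
apply: memv_suml => i _; rewrite linearZ memvZ //.
rewrite /= /lie_flip (coord_vbasis Vv) linear_sum.
apply: memv_suml => j _; rewrite linearZ memvZ //.
by apply: memv_span; apply: allpairs_f; rewrite -tnth_nth mem_tnth.
Qed.

Definition derived_algebra : {vspace g} := lie_prodv fullv fullv.

Definition two_step_nilpotent : Prop := lie_prodv fullv derived_algebra = 0%VS.

Definition genus2 : Prop := \dim derived_algebra = 2.

Definition derivation D : Prop :=
  forall x y, D (lie x y) = lie (D x) y + lie x (D y).

Definition almost_inner D : Prop :=
  derivation D /\ forall x, exists y, D x = lie y x.

Definition inner D : Prop := exists y, forall x, D x = lie y x.

Definition AID : {vspace 'End(g)} := subspace_of almost_inner.

Definition Inn : {vspace 'End(g)} := subspace_of inner.

Lemma InnP D : D \in Inn <-> inner D.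
Proof.
apply: mem_subspace_of => [|a D1 D2 [y1 D1E] [y2 D2E]].
  by exists 0 => x; rewrite lfunE lie0l.
by exists (a *: y1 + y2) => x; rewrite !lfunE /= lfunE /= D1E D2E lie_linearl.
Qed.

Lemma AIDP D : D \in AID <-> almost_inner D.
Proof.
apply: mem_subspace_of => [|a D1 D2 [der1 ai1] [der2 ai2]].
  split=> [x y|x]; first by rewrite !lfunE /= lie0l lie0r addr0.
  by exists 0; rewrite lfunE lie0l.
split=> [x y|x].
  rewrite !lfunE /= !lfunE /= der1 der2 lie_linearl lie_linearr scalerDr.
  by rewrite addrACA.
have [[y1 D1E] [y2 D2E]] := (ai1 x, ai2 x).
by exists (a *: y1 + y2); rewrite !lfunE /= lfunE /= D1E D2E lie_linearl.
Qed.

(* (x, y1, y2) is a basis of g adapted to [g, g], and A, B are the matrices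
   of structure constants: the associated pencil is mu A + lambda B. *)
Definition associated_matrices n (x : n.-tuple g) (y1 y2 : g)
    (A B : 'M[K]_n) : Prop :=
  [/\ basis_of fullv (x ++ [:: y1; y2]),
      basis_of derived_algebra [:: y1; y2] &
      forall i j : 'I_n,
        lie (tnth x i) (tnth x j) = A i j *: y1 + B i j *: y2].

End LieAlgebras.

(* Divisibility in a domain; [_ %| _] of polydiv is pseudo-divisibility, which
   is not divisibility in {poly {poly K}}. *)
Section Factorization.
Variable S : idomainType.
Implicit Types (a b d p : S).

Definition divides d a : Prop := exists c, a = c * d.

Definition associates a b : Prop := exists2 u, u \is a GRing.unit & a = u * b.

Definition prime_elt p : Prop :=
  [/\ p != 0, p \isn't a GRing.unit &
      forall a b, divides p (a * b) -> divides p a \/ divides p b].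

Definition is_gcd (P : S -> Prop) d : Prop :=
  (forall a, P a -> divides d a) /\
  (forall c, (forall a, P a -> divides c a) -> divides c d).

(* a = unit * \prod_i p_i ^ e_i, with s the list of the (p_i, e_i). *)
Definition factorization a (s : seq (S * nat)) : Prop :=
  [/\ forall q, q \in s -> prime_elt q.1 /\ (0 < q.2)%N,
      forall i j, (i < j < size s)%N ->
        ~ associates (nth (0, 0%N) s i).1 (nth (0, 0%N) s j).1 &
      associates a (\prod_(q <- s) q.1 ^+ q.2)].

Definition is_minor n (P : 'M[S]_n) m a : Prop :=
  exists h k : 'I_m -> 'I_n,
    [/\ {homo h : i j / (i < j)%N}, {homo k : i j / (i < j)%N} &
        a = \det (mxsub h k P)].

Definition rank_frac n (P : 'M[S]_n) : nat :=
  \rank (map_mx (@tofrac S) P).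

Definition invariant_factors n (P : 'M[S]_n) (i_ : nat -> S) : Prop :=
  exists G : nat -> S,
    [/\ forall m, (1 <= m <= rank_frac P)%N -> is_gcd (is_minor P m) (G m),
        i_ 1%N = G 1%N &
        forall m, (1 < m <= rank_frac P)%N -> i_ m * G m.-1 = G m].

(* E is the list, with multiplicity and in some order, of the prime powers in
   factorizations of the invariant factors. The primes being arbitrary
   up to units, so is each entry of E. *)
Definition elementary_divisors n (P : 'M[S]_n) (E : seq S) : Prop :=
  exists (i_ : nat -> S) (fac : nat -> seq (S * nat)),
    [/\ invariant_factors P i_,
        forall m, (1 <= m <= rank_frac P)%N -> factorization (i_ m) (fac m) &
        perm_eq E (flatten [seq [seq q.1 ^+ q.2 | q <- fac m]
                           | m <- iota 1 (rank_frac P)])].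

End Factorization.

Section Pencils.
Variable K : fieldType.

(* K[lambda, mu] is encoded as K[mu][lambda] = {poly {poly K}}. *)
Definition lam : {poly {poly K}} := 'X.
Definition mu : {poly {poly K}} := 'X%:P.
Definition cst (a : K) : {poly {poly K}} := a%:P%:P.

Definition pencil n (A B : 'M[K]_n) : 'M[{poly {poly K}}]_n :=
  mu *: map_mx cst A + lam *: map_mx cst B.

Section MinimalIndices.
Variable n : nat.
Implicit Types (A B : 'M[K]_n) (X : seq 'cV[{poly K}]_n).

(* (A + lambda B) z = 0 with z in K[lambda]^n *)
Definition pencil_solution A B (z : 'cV[{poly K}]_n) : Prop :=
  (map_mx polyC A + 'X *: map_mx polyC B) *m z = 0.

Definition poly_independent X : Prop :=
  forall c : 'I_(size X) -> {poly K},
    \sum_(i < size X) c i *: X`_i = 0 -> forall i, c i = 0.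

Definition vec_degree (z : 'cV[{poly K}]_n) : nat :=
  \max_(i < n) (size (z i ord0)).-1.

(* X is the outcome of the greedy choice of solutions of minimal degree. *)
Definition minimal_solutions A B X : Prop :=
  [/\ forall z, z \in X -> pencil_solution A B z,
      poly_independent X,
      forall j z, (j < size X)%N -> pencil_solution A B z ->
        poly_independent (rcons (take j X) z) ->
        (vec_degree X`_j <= vec_degree z)%N &
      forall z, pencil_solution A B z -> ~ poly_independent (rcons X z)].

Definition minimal_indices A B (eps : seq nat) : Prop :=
  if \det (pencil A B) == 0 then
    exists2 X, minimal_solutions A B X & eps = [seq vec_degree z | z <- X]
  else eps = [::].

End MinimalIndices.

End Pencils.

Section RealPencils.
Variable R : realType.
Implicit Types (es : seq nat) (fs : seq (R * nat)) (ms : seq (R[i] * nat)).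

Definition xi (b : R[i]) : {poly {poly R}} :=
  let a := complex.Re b in let c := complex.Im b in
  lam R ^+ 2 - cst (2 * a) * lam R * mu R + cst (a ^+ 2 + c ^+ 2) * mu R ^+ 2.

(* One polynomial for each pair (infty, e), (alpha, f), (beta, m). *)
Definition half_divisors es fs ms : seq {poly {poly R}} :=
  [seq mu R ^+ e | e <- es] ++
  [seq (lam R - mu R * cst q.1) ^+ q.2 | q <- fs] ++
  [seq xi q.1 ^+ q.2 | q <- ms].

Definition elementary_divisor_pairs n (A B : 'M[R]_n) es fs ms : Prop :=
  [/\ forall e, e \in es -> (1 <= e)%N,
      forall q, q \in fs -> (1 <= q.2)%N,
      forall q, q \in ms -> complex.Im q.1 != 0 /\ (1 <= q.2)%N &
      elementary_divisors (pencil A B)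
        (half_divisors es fs ms ++ half_divisors es fs ms)].

End RealPencils.

(* Main.v *)
From HB Require Import structures.
Require Import Defs.
From mathcomp Require Import all_boot all_order all_algebra all_fingroup.
From mathcomp Require Import boolp reals.
From mathcomp.real_closed Require Import complex polyrcf.
From mathcomp Require Import zify ring.

Set Implicit Arguments.
Unset Strict Implicit.
Unset Printing Implicit Defensive.

Import Order.TTheory GRing.Theory Num.Theory.

(** An almost inner derivation maps the Lie algebra into its derived algebra,
    which is central, and kills it; so it is given by two rows d1, d2 of
    coordinates.  The condition D x \in [g, x], read by duality for one x at a
    time, says that s d1 + t d2 lies in the row space of s A + t B for all real
    (s, t).  Equivalently, the polynomial row z = d1 + t d2 of degree at most 1
    has z(t) in the row space of M(t) = A + t B for all real t, and d2 lies in
    the row space of B.  Inner derivations are the rows z = y M with y constant.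

    Replacing B by B + c A with c generic ([generic_chart]) only changes the
    affine coordinate of the projective line, and makes infinity an ordinary
    point: the rank of B becomes the generic rank r of M.  The condition at
    infinity then follows from the others, because the rank of a polynomial
    matrix at some real point is at least the rank of its leading coefficient
    ([rank_top_le], [pointwise_image_top]).

    Let N_k be the space of rows of degree at most k + 1 with z(t) in the row
    space of M(t) for all real t; N_0 is the space of almost inner derivations.
    The leading coefficient identifies N_(k+1) / N_k with the row space of B,
    so dim N_k = dim AID + k r ([polydim_pointwise_image]).  On the other hand,
    let M = U diag(d_i) V be the Smith normal form ([smith_form]).  A row lies
    in some N_k iff its coordinates with respect to V vanish at the real roots
    of the d_i, while it is a multiple of M iff these coordinates are
    divisible by the d_i.  Hence, for large k, N_k is the sum of the multiples
    y M with y of degree at most k and of a space of dimension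
    sum_i theta(d_i), where theta(f) is the degree of f minus its number of
    distinct real roots, and theta(0) = 0
    ([pointwise_image_cover], [pointwise_image_kernel]).

    The minimal solutions generate all solutions of y M = 0, without cancellation
    of leading terms, so those of degree at most k form a space of dimension
    sum_j max(0, k + 1 - eps_j) ([polydim_row_sol]).  Therefore
      sum_i theta(d_i) + n (k + 1) = sum_j (k + 1 - eps_j) + dim AID + k r
    for all large k ([pointwise_image_count]).  Two consecutive values of k give
    r = n - #{eps_j}, then dim AID = sum_i theta(d_i) + sum_j eps_j + r, and
    dim Inn = n - #{j | eps_j = 0} is the same count for constant y.

    It remains to see that sum_i theta(d_i) is the contribution of the
    elementary divisors.  Setting lambda = t, mu = 1 + c t maps the i-th
    invariant factor of the homogeneous pencil to d_i up to a unit, since a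
    common divisor of the dehomogenized minors can be homogenized
    ([dehomog_gcd], [dehomog_invariant_factor]).  As theta is additive on
    products without common real roots, each real linear form to the power e
    contributes e - 1, and xi^m, which has no real root, contributes 2 m
    ([factorization_excess], [half_divisors_excess]). *)

(** * Smith normal form of a polynomial matrix *)

Section SmithForm.
Local Open Scope ring_scope.
Variable F : fieldType.

Lemma transvection_unit n (i j : 'I_n) (q : {poly F}) :
  i != j -> 1%:M + q *: delta_mx i j \in unitmx.
Proof.
move=> neq_ij; have dd : delta_mx i j *m delta_mx i j = 0 :> 'M[{poly F}]_n.
  by rewrite mul_delta_mx_0 // eq_sym.
apply: (proj1 (@mulmx1_unit _ _ _ (1%:M - q *: delta_mx i j) _)).
rewrite mulmxBr mulmx1 -scalemxAr mulmxDl mul1mx -scalemxAl dd.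
by rewrite scaler0 addr0 addrK.
Qed.

(** The corner entry is a nonzero entry of least degree among all the matrices
    equivalent to M; this extremal choice replaces the Euclidean algorithm. *)
Definition min_corner n (M : 'M[{poly F}]_n.+1) :=
  M 0 0 != 0 /\ forall L R i j, L \in unitmx -> R \in unitmx ->
    (L *m M *m R) i j != 0 -> (size (M 0%R 0%R) <= size ((L *m M *m R) i j))%N.

Lemma min_corner_tr n (M : 'M[{poly F}]_n.+1) : min_corner M -> min_corner M^T.
Proof.
move=> [nz min]; split=> [|L R i j uL uR]; first by rewrite mxE.
have ->: L *m M^T *m R = (R^T *m M *m L^T)^T by rewrite !trmx_mul !trmxK mulmxA.
by rewrite [_^T i j]mxE [M^T _ _]mxE; apply: min; rewrite unitmx_tr.
Qed.

Lemma min_corner_equiv n (M L : 'M[{poly F}]_n.+1) :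
  L \in unitmx -> (L *m M) 0 0 = M 0 0 -> min_corner M -> min_corner (L *m M).
Proof.
move=> uL eq00 [nz min]; split=> [|L' R i j uL' uR]; first by rewrite eq00.
by rewrite eq00 mulmxA; apply: min; rewrite // unitmx_mul uL'.
Qed.

Lemma delta_mxM n (N : 'M[{poly F}]_n) (a b c k : 'I_n) :
  (delta_mx a b *m N) c k = N b k *+ (c == a).
Proof.
rewrite mxE (bigD1 b) //= big1 => [|l l_nb].
  by rewrite mxE eqxx andbT addr0; case: (c == a); rewrite (mul1r, mul0r).
by rewrite mxE (negPf l_nb) andbF mul0r.
Qed.

(** Otherwise a row operation would replace the entry by its nonzero remainder
    modulo the corner, of smaller degree. *)
Lemma min_corner_dvd_col n (M : 'M[{poly F}]_n.+1) i :
  min_corner M -> M 0 0 %| M i 0.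
Proof.
move=> [nz min]; have [-> //|i_n0] := eqVneq i 0.
pose q := M i 0 %/ M 0 0; pose L := 1%:M + (- q) *: delta_mx i 0.
have Li : (L *m M *m 1%:M) i 0 = M i 0 %% M 0 0.
  rewrite mulmx1 mulmxDl mul1mx -scalemxAl mxE [X in _ + X]mxE delta_mxM eqxx.
  by rewrite [in LHS](divp_eq (M i 0) (M 0 0)) -/q mulr1n mulNr addrAC subrr add0r.
rewrite /dvdp; apply: contraT => mod_n0.
have uL : L \in unitmx by exact: transvection_unit.
have := min L 1%:M i 0 uL (unitmx1 _ _); rewrite Li => /(_ mod_n0).
by rewrite leqNgt ltn_modp nz.
Qed.

(** Clearing the entry (i, 0) and then adding row i to row 0 keeps the corner and
    brings M i j, up to a multiple of the corner, into the first row. *)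
Lemma min_corner_dvd n (M : 'M[{poly F}]_n.+1) i j :
  min_corner M -> M 0 0 %| M i j.
Proof.
move=> min; have dvd_row k : M 0 0 %| M 0 k.
  by have := min_corner_dvd_col k (min_corner_tr min); rewrite !mxE.
have [->|i_n0] := eqVneq i 0; first exact: dvd_row.
have /dvdpP [q Mi0] := min_corner_dvd_col i min.
pose L := (1%:M + 1 *: delta_mx 0 i) *m (1%:M + (- q) *: delta_mx i 0).
have uL : L \in unitmx.
  by rewrite unitmx_mul !transvection_unit // eq_sym.
have LE k : (L *m M) 0 k = M 0 k + (M i k - q * M 0 k).
  have LrE l : ((1%:M + (- q) *: delta_mx i 0) *m M) l k
             = M l k - q * M 0 k *+ (l == i).
    rewrite mulmxDl mul1mx -scalemxAl mxE [X in _ + X]mxE delta_mxM.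
    by rewrite mulrnAr mulNr mulNrn.
  rewrite /L -mulmxA mulmxDl mul1mx scale1r mxE delta_mxM eqxx mulr1n !LrE.
  by rewrite eqxx eq_sym (negPf i_n0) mulr0n subr0 mulr1n.
have L00 : (L *m M) 0 0 = M 0 0 by rewrite LE Mi0 subrr addr0.
have := min_corner_dvd_col j (min_corner_tr (min_corner_equiv uL L00 min)).
rewrite mxE L00 mxE LE dvdp_addr ?dvd_row // dvdp_subl //.
by rewrite dvdp_mull // dvd_row.
Qed.

Lemma min_corner_exists n (M : 'M[{poly F}]_n.+1) : M != 0 ->
  exists L R, [/\ L \in unitmx, R \in unitmx & min_corner (L *m M *m R)].
Proof.
move=> M_n0.
pose P s := `[< exists L R i j, [/\ L \in unitmx, R \in unitmx,
   (L *m M *m R) i j != 0 & size ((L *m M *m R) i j) = s] >].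
have exP : exists s, P s.
  have [i [j Mij]] : exists i j, M i j != 0.
    apply: contrapT => /forallNP M0; move/eqP: M_n0; apply; apply/matrixP=> i j.
    by have /forallNP /(_ j) /negP := M0 i; rewrite negbK mxE => /eqP.
  exists (size (M i j)); apply/asboolP; exists 1%:M, 1%:M, i, j.
  by rewrite mul1mx mulmx1 !unitmx1.
have [s /asboolP [L [R [i [j [uL uR nz sz]]]]] smin] := ex_minnP exP.
exists (tperm_mx 0 i *m L), (R *m tperm_mx 0 j).
have NE : (tperm_mx 0 i *m L *m M *m (R *m tperm_mx 0 j))
        = xrow 0 i (xcol 0 j (L *m M *m R)).
  by rewrite xcolE xrowE !mulmxA.
have uL' : tperm_mx 0 i *m L \in unitmx by rewrite unitmx_mul unitmx_perm.
have uR' : R *m tperm_mx 0 j \in unitmx by rewrite unitmx_mul unitmx_perm uR.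
have N00 : xrow 0 i (xcol 0 j (L *m M *m R)) 0 0 = (L *m M *m R) i j.
  by rewrite mxE mxE !tpermL.
split=> //; split=> [|L' R' k l uL1 uR1 nz1]; first by rewrite NE N00.
rewrite [in X in (X <= _)%N]NE N00 sz; apply: smin; apply/asboolP.
exists (L' *m (tperm_mx 0 i *m L)), (R *m tperm_mx 0 j *m R'), k, l.
split; first by rewrite unitmx_mul uL1.
- by rewrite unitmx_mul uR'.
- by move: nz1; rewrite !mulmxA.
by rewrite !mulmxA.
Qed.

Definition dvd_chain n (d : 'rV[{poly F}]_n) :=
  forall i j : 'I_n, (i <= j)%N -> d 0 i %| d 0 j.

(** Once the corner divides every entry it can be factored out of the whole
    matrix, so the divisibility chain comes for free from the induction. *)
Theorem smith_form n (M : 'M[{poly F}]_n) :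
  exists U V d,
    [/\ U \in unitmx, V \in unitmx, M = U *m diag_mx d *m V & dvd_chain d].
Proof.
elim: n M => [|n IHn] M.
  exists 1%:M, 1%:M, 0; rewrite !unitmx1; split=> // [|[] //].
  by apply/matrixP=> -[].
have [->|M_n0] := eqVneq M 0.
  exists 1%:M, 1%:M, 0; rewrite !unitmx1 raddf0 mulmx0 mul0mx.
  by split=> // i j _; rewrite !mxE.
have [L [R [uL uR min]]] := min_corner_exists M_n0.
set a := (L *m M *m R) 0 0.
pose M2 : 'M_(1 + n) := \matrix_(i, j) ((L *m M *m R) i j %/ a).
have ME : L *m M *m R = a *: M2.
  apply/matrixP=> i j; rewrite [RHS]mxE [X in _ * X]mxE mulrC divpK //.
  exact: min_corner_dvd.
have M2_00 : ulsubmx M2 = 1%:M.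
  apply/matrixP=> i j; rewrite !ord1 mxE [LHS]mxE [LHS]mxE !lshift0 divpp;
    last by case: min.
  by rewrite mxE.
pose u := ursubmx M2; pose v := dlsubmx M2.
have [U [V [d [uU uV dE d_dvd]]]] := IHn (drsubmx M2 - v *m u).
pose U2 : 'M_(1 + n) := block_mx 1%:M 0 v 1%:M *m block_mx 1%:M 0 0 U.
pose V2 : 'M_(1 + n) := block_mx 1%:M 0 0 V *m block_mx 1%:M u 0 1%:M.
have uU2 : U2 \in unitmx.
  by rewrite unitmx_mul !unitmxE !det_lblock !det1 !mul1r unitr1 -unitmxE.
have uV2 : V2 \in unitmx.
  by rewrite unitmx_mul !unitmxE det_lblock det_ublock !det1 !mul1r unitr1
    -unitmxE uV.
exists (invmx L *m U2), (V2 *m invmx R), (a *: row_mx 1%:M d).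
split.
- by rewrite unitmx_mul unitmx_inv uL.
- by rewrite unitmx_mul unitmx_inv uR uV2.
- have M2E : M2 = U2 *m diag_mx (row_mx 1%:M d) *m V2.
    rewrite /U2 /V2 diag_mx_row !mulmx_block !mulmx0 !mul0mx !mul1mx !mulmx1.
    rewrite !addr0 !add0r.
    have -> : diag_mx 1%:M = 1%:M :> 'M[{poly F}]_1.
      by apply/matrixP=> i j; rewrite !mxE !ord1.
    rewrite ?mul1mx ?mulmx1 ?mul0mx ?add0r ?addr0 mulmx0 addr0.
    rewrite -dE [v *m u + _]addrC subrK -M2_00.
    by rewrite submxK.
  have -> : M = invmx L *m (a *: M2) *m invmx R.
    by rewrite -ME !mulmxA mulVmx // mul1mx mulmxK.
  have diagZ : diag_mx (a *: row_mx 1%:M d) = a *: diag_mx (row_mx 1%:M d).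
    exact: linearZ.
  by rewrite M2E diagZ -!(scalemxAl, scalemxAr) !mulmxA.
move=> i j; rewrite !mxE; case: splitP => i' ->; case: splitP => j' ->.
- by rewrite !ord1 !mxE.
- by rewrite !ord1 !mxE mulr1 dvdp_mulr.
- by rewrite !ord1.
by rewrite leq_add2l => le_ij; apply: dvdp_mul; rewrite ?dvdpp ?d_dvd.
Qed.

End SmithForm.

(** * Dimensions of spaces of polynomial rows *)

Section PolyDim.
Local Open Scope ring_scope.
Variable K : fieldType.
Local Notation "v ^P" := (map_mx polyC v) (at level 2, format "v ^P").

(** The K-dimension of a K-subspace P of the infinite-dimensional space of
    polynomial rows: the rows of Q form a basis of P. *)
Definition polydim n (P : 'rV[{poly K}]_n -> Prop) m :=
  exists2 Q : 'M[{poly K}]_(m, n),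
    forall v : 'rV[K]_m, v^P *m Q = 0 -> v = 0 &
    forall z, P z <-> exists v : 'rV[K]_m, z = v^P *m Q.

Lemma polydim_ext n (P P' : 'rV[{poly K}]_n -> Prop) m :
  (forall z, P z <-> P' z) -> polydim P m -> polydim P' m.
Proof. by move=> PP' [Q inj PQ]; exists Q => // z; rewrite -PP'. Qed.

Lemma polydim_coords n (P : 'rV[{poly K}]_n -> Prop) m k
    (Q : 'M[{poly K}]_(m, n)) (Q' : 'M[{poly K}]_(k, n)) :
  (forall z, P z <-> exists v : 'rV[K]_m, z = v^P *m Q) ->
  (forall i, P (row i Q')) -> exists W : 'M[K]_(k, m), Q' = W^P *m Q.
Proof.
move=> PQ PQ'; have rowQ i : exists w : 'rV[K]_m, row i Q' = w^P *m Q.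
  exact/PQ/PQ'.
have [w wE] := fin_all_exists rowQ.
exists (\matrix_i w i); apply/row_matrixP => i.
by rewrite wE row_mul -map_row rowK.
Qed.

Lemma polydim_row n (P : 'rV[{poly K}]_n -> Prop) m (Q : 'M[{poly K}]_(m, n)) :
  (forall z, P z <-> exists v : 'rV[K]_m, z = v^P *m Q) -> forall i, P (row i Q).
Proof.
by move=> PQ i; apply/PQ; exists (delta_mx 0 i); rewrite map_delta_mx -rowE.
Qed.

Lemma row_free_inj0 m p (W : 'M[K]_(m, p)) :
  (forall v : 'rV_m, v *m W = 0 -> v = 0) -> row_free W.
Proof.
move=> inj; rewrite -kermx_eq0; apply/rowV0P => v /sub_kermxP; exact: inj.
Qed.

Lemma polydim_le n (P P' : 'rV[{poly K}]_n -> Prop) m m' :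
  (forall z, P z -> P' z) -> polydim P m -> polydim P' m' -> (m <= m')%N.
Proof.
move=> PP' [Q inj PQ] [Q' inj' PQ'].
have [W QE] := polydim_coords PQ' (fun i => PP' _ (polydim_row PQ i)).
have /eqP <- : row_free W; last exact: rank_leq_col.
apply: row_free_inj0 => v vW; apply: inj.
by rewrite QE mulmxA -map_mxM vW map_mx0 mul0mx.
Qed.

Lemma polydim_uniq n (P : 'rV[{poly K}]_n -> Prop) m m' :
  polydim P m -> polydim P m' -> m = m'.
Proof.
by move=> Pm Pm'; apply/eqP; rewrite eqn_leq !(polydim_le (P := P) (P' := P)).
Qed.

Lemma polydim_vspace n (vT : vectType K) (U : {vspace vT})
    (f : vT -> 'rV[{poly K}]_n) :
  (forall a u v, f (a *: u + v) = a%:P *: f u + f v) ->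
  (forall u, u \in U -> f u = 0 -> u = 0) ->
  polydim (fun z => exists2 u, u \in U & z = f u) (\dim U).
Proof.
move=> flin finj.
pose comb (v : 'rV[K]_(\dim U)) := \sum_i v 0 i *: (vbasis U)`_i.
have f0 : f 0 = 0.
  have := flin 1 0 0; rewrite !scale1r addr0 => /esym/eqP.
  by rewrite -subr_eq0 addrK => /eqP.
have fsum (v : 'rV[K]_(\dim U)) :
    f (comb v) = v^P *m \matrix_i f (vbasis U)`_i.
  rewrite mulmx_sum_row /comb.
  have: forall s : seq 'I_(\dim U), f (\sum_(i <- s) v 0 i *: (vbasis U)`_i) =
      \sum_(i <- s) v^P 0 i *: row i (\matrix_i f (vbasis U)`_i).
    elim=> [|i s IHs]; first by rewrite !big_nil.
    by rewrite !big_cons flin IHs mxE rowK.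
  exact.
have combU v : comb v \in U.
  apply: memv_suml => i _; apply/memvZ/vbasis_mem.
  by apply: mem_nth; rewrite size_tuple.
exists (\matrix_i f (vbasis U)`_i) => [v|z]; last first.
  split=> [[u Uu ->]|[v ->]]; last by exists (comb v).
  exists (\row_i coord (vbasis U) i u); rewrite -fsum; congr f.
  rewrite {1}(coord_vbasis Uu).
  by apply: eq_bigr => i _; rewrite mxE.
rewrite -fsum => /(finj _ (combU v)) v0; apply/rowP => i; rewrite mxE.
by have /freeP := basis_free (vbasisP U); apply; exact: v0.
Qed.

Lemma polydim_klin n n' (P : 'rV[{poly K}]_n -> Prop) m
    (f : 'rV[{poly K}]_n -> 'rV[{poly K}]_n') :
  (forall a u v, f (a%:P *: u + v) = a%:P *: f u + f v) ->
  (forall z, P z -> f z = 0 -> z = 0) ->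
  polydim P m -> polydim (fun z' => exists2 z, P z & z' = f z) m.
Proof.
move=> flin finj [Q inj PQ].
have := @polydim_vspace n' 'rV[K]_m fullv (fun v => f (v^P *m Q)).
rewrite dimvf [dim _]mul1n => dimf; apply: polydim_ext (dimf _ _) => [z'|a u v|v _].
- split=> [[u _ ->]|[z /PQ [v ->] ->]]; last by exists v; rewrite ?memvf.
  by exists (u^P *m Q) => //; apply/PQ; exists u.
- by rewrite map_mxD map_mxZ mulmxDl -scalemxAl flin.
by move=> /(finj _ ((PQ _).2 (ex_intro _ v erefl))); exact: inj.
Qed.

Lemma polydim_add n (P P' : 'rV[{poly K}]_n -> Prop) m m' :
  (forall x y, P x -> P' y -> x + y = 0 -> x = 0 /\ y = 0) ->
  polydim P m -> polydim P' m' ->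
  polydim (fun z => exists x y, [/\ P x, P' y & z = x + y]) (m + m').
Proof.
move=> disj [Q inj PQ] [Q' inj' PQ']; exists (col_mx Q Q') => [v|z].
  rewrite -[v]hsubmxK map_row_mx mul_row_col => /disj [||/inj -> /inj' ->].
  - by apply/PQ; exists (lsubmx v).
  - by apply/PQ'; exists (rsubmx v).
  by rewrite row_mx0.
split=> [[x [y [/PQ [u ->] /PQ' [v ->] ->]]]|[v ->]].
  by exists (row_mx u v); rewrite map_row_mx mul_row_col.
exists ((lsubmx v)^P *m Q), ((rsubmx v)^P *m Q').
split; [by apply/PQ; eexists|by apply/PQ'; eexists|].
by rewrite -mul_row_col -map_row_mx hsubmxK.
Qed.

Lemma polydim_rank_nullity n n' (P : 'rV[{poly K}]_n -> Prop)
    (H : 'M[{poly K}]_(n, n')) m s i :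
  polydim P m ->
  polydim (fun z => P z /\ z *m H = 0) s ->
  polydim (fun z' => exists2 z, P z & z' = z *m H) i -> m = (s + i)%N.
Proof.
move=> [Q inj PQ] dimK [Q' inj' PQ'].
have PvQ v : P (v^P *m Q) by apply/PQ; exists v.
have [W QH] : exists W : 'M[K]_(m, i), Q *m H = W^P *m Q'.
  apply: (polydim_coords PQ') => j; rewrite row_mul.
  by exists (row j Q) => //; apply: polydim_row PQ j.
have rankW : \rank W = i.
  apply/eqP; rewrite -[_ == i]/(row_full W) -sub1mx; apply/row_subP => j.
  have [_ /PQ [v ->]] := polydim_row PQ' j;
    rewrite -mulmxA QH mulmxA -map_mxM => Q'j.
  suff ->: row j 1%:M = v *m W by apply: submxMl.
  apply/eqP; rewrite -subr_eq0; apply/eqP/inj'.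
  by rewrite map_mxB mulmxBl -Q'j row1 map_delta_mx -rowE subrr.
suff dimK' : polydim (fun z => P z /\ z *m H = 0) (\rank (kermx W)).
  by rewrite (polydim_uniq dimK dimK') mxrank_ker rankW subnK // -rankW
    rank_leq_row.
exists ((row_base (kermx W))^P *m Q) => [v|z].
  rewrite mulmxA -map_mxM => /inj vB0.
  have := row_base_free (kermx W) => /row_free_inj; apply.
  by rewrite vB0 mul0mx.
split=> [[/PQ [v ->]]|[v ->]].
  rewrite -mulmxA QH mulmxA -map_mxM => /inj' vW0.
  have: (v <= row_base (kermx W))%MS by rewrite eq_row_base; apply/sub_kermxP.
  by move=> /submxP [w ->]; exists w; rewrite map_mxM mulmxA.
rewrite mulmxA -map_mxM; split; first exact: PvQ.
rewrite -mulmxA QH mulmxA -map_mxM.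
suff ->: v *m row_base (kermx W) *m W = 0 by rewrite map_mx0 mul0mx.
apply/sub_kermxP; rewrite -(eq_row_base (kermx W)); exact: submxMl.
Qed.

(** The coefficients below the degree bounds are free coordinates. *)
Lemma polydim_box n (theta : 'I_n -> nat) :
  polydim (fun z => forall i, (size (z ord0 i) <= theta i)%N) (\sum_i theta i).
Proof.
pose T := {i : 'I_n & 'I_(theta i)}.
pose f (u : {ffun T -> K^o}) : 'rV[{poly K}]_n :=
  \row_i \sum_(j < theta i) u (Tagged (fun i => 'I_(theta i)) j) *: 'X^j.
have coef_f u i (j : 'I_(theta i)) :
    (f u 0 i)`_j = u (Tagged (fun i => 'I_(theta i)) j).
  rewrite mxE coef_sum (bigD1 j) //= big1 ?addr0 => [|k k_nj].
    by rewrite coefZ coefXn eqxx mulr1.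
  by rewrite coefZ coefXn eq_sym (inj_eq val_inj) (negPf k_nj) mulr0.
have := @polydim_vspace n {ffun T -> K^o} fullv f.
have -> : \dim (@fullv K {ffun T -> K^o}) = \sum_i theta i.
  rewrite dimvf [dim _]muln1 card_tagged sumnE big_map big_enum /=.
  by apply: eq_bigr => i _; rewrite card_ord.
move=> dimf; apply: polydim_ext (dimf _ _) => [z|a u v|u _ fu0].
- split=> [[u _ -> i]|size_z].
    rewrite mxE; apply: (leq_trans (size_sum _ _ _)).
    apply/bigmax_leqP => j _; apply: (leq_trans (size_scale_leq _ _)).
    by rewrite size_polyXn.
  exists [ffun t : T => (z 0 (tag t))`_(tagged t)]; first exact: memvf.
  apply/rowP => i; apply/polyP => j; case: (ltnP j (theta i)) => [lt_j|le_j].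
    by rewrite (coef_f _ _ (Ordinal lt_j)) ffunE.
  rewrite nth_default ?(leq_trans (size_z i)) // mxE coef_sum big1 // => k _.
  rewrite coefZ coefXn; case: eqP => [jk|_]; last by rewrite mulr0.
  by move: le_j; rewrite jk leqNgt ltn_ord.
- apply/rowP => i; rewrite !mxE mulr_sumr -big_split /=.
  by apply: eq_bigr => j _; rewrite !ffunE mul_polyC scalerDl scalerA.
apply/ffunP => -[i j]; rewrite ffunE.
by have := coef_f u i j; rewrite fu0 mxE coef0.
Qed.

End PolyDim.

(** * Minimal indices and the dimension of the solution spaces *)

Section LinearPencil.
Local Open Scope ring_scope.
Variables (K : fieldType) (n : nat).
Implicit Types (A B : 'M[K]_n) (z : 'rV[{poly K}]_n).

Definition lpencil A B : 'M[{poly K}]_n := map_mx polyC A + 'X *: map_mx polyC B.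

Definition row_sol A B d z :=
  z *m lpencil A B = 0 /\ forall i, (size (z ord0 i) <= d)%N.

End LinearPencil.

Section MinimalSolutions.
Local Open Scope ring_scope.
Variable K : fieldType.

Lemma coefM_top (p q : {poly K}) a b :
  (size p <= a.+1)%N -> (size q <= b.+1)%N -> (p * q)`_(a + b) = p`_a * q`_b.
Proof.
move=> sp sq; have lt_a : (a < (a + b).+1)%N by rewrite ltnS leq_addr.
rewrite coefM (bigD1 (Ordinal lt_a)) //= addKn big1 ?addr0 // => i i_na.
have [lt_ia|lt_ai|eq_ia] := ltngtP i a.
- by rewrite [q`_ _]nth_default ?mulr0 //; apply: leq_trans sq _; lia.
- by rewrite nth_default ?mul0r //; apply: leq_trans sp _.
by case/eqP: i_na; apply: val_inj.
Qed.

Variable n : nat.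
Implicit Types (X Y : seq 'cV[{poly K}]_n) (z : 'cV[{poly K}]_n)
  (c : nat -> {poly K}).

Lemma poly_independentP X :
  poly_independent X <->
  forall c, \sum_(i < size X) c i *: X`_i = 0 -> forall i, (i < size X)%N -> c
    i = 0.
Proof.
split=> [ind c c0 i lt_i|ind c c0 i].
  exact: (ind (fun i => c i) c0 (Ordinal lt_i)).
pose c' m := if insub m is Some i then c i else 0.
have c'E (j : 'I_(size X)) : c' j = c j by rewrite /c' valK.
by rewrite -c'E; apply: ind => //; under eq_bigr do rewrite c'E.
Qed.

Lemma poly_independent_rcons X j z : (j <= size X)%N ->
  poly_independent (rcons (take j X) z) <->
  forall c b, \sum_(i < j) c i *: X`_i + b *: z = 0 ->
    b = 0 /\ forall i, (i < j)%N -> c i = 0.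
Proof.
move=> le_j; have szY : size (rcons (take j X) z) = j.+1.
  by rewrite size_rcons size_takel.
have sumE c : \sum_(i < size (rcons (take j X) z)) c i *: (rcons (take j X) z)`_i
    = \sum_(i < j) c i *: X`_i + c j *: z.
  rewrite szY big_ord_recr /= nth_rcons size_takel // ltnn eqxx; congr (_ + _).
  by apply: eq_bigr => i _; rewrite nth_rcons size_takel // ltn_ord nth_take.
rewrite poly_independentP szY; split=> [ind c b cb0|ind c].
  pose c' i := if (i < j)%N then c i else b.
  have c'0 : forall i, (i < j.+1)%N -> c' i = 0.
    rewrite -szY; move: (ind c'); rewrite -szY sumE; apply.
    rewrite -[RHS]cb0 /c' ltnn; congr (_ + _).
    by apply: eq_bigr => i _; rewrite ltn_ord.
  split=> [|i lt_i]; first by have := c'0 j (leqnn _); rewrite /c' ltnn.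
  by have := c'0 i (ltnW lt_i); rewrite /c' lt_i.
rewrite -szY sumE szY => /ind [cj0 ci0] i.
by rewrite ltnS leq_eqVlt => /orP [/eqP ->|/ci0].
Qed.

Lemma size_vec_degree z r : (size (z r ord0) <= (vec_degree z).+1)%N.
Proof.
apply: leq_trans (leqSpred _) _; rewrite ltnS.
exact: (leq_bigmax (F := fun r => (size (z r ord0)).-1)).
Qed.

Variables (A B : 'M[K]_n) (X : seq 'cV[{poly K}]_n).
Hypothesis minX : minimal_solutions A B X.
Let k := size X.
Let eps i := vec_degree X`_i.

Let X_sol z : z \in X -> pencil_solution A B z.
Proof. by case: minX => + _ _ _; exact. Qed.

Let X_ind c : \sum_(i < k) c i *: X`_i = 0 -> forall i, (i < k)%N -> c i = 0.
Proof. by case: minX => _ /poly_independentP ind _ _; apply: ind. Qed.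

Let X_greedy j z : (j < k)%N -> pencil_solution A B z ->
  (forall c b, \sum_(i < j) c i *: X`_i + b *: z = 0 ->
    b = 0 /\ forall i, (i < j)%N -> c i = 0) ->
  (eps j <= vec_degree z)%N.
Proof.
move=> lt_j zsol ind; case: minX => _ _ greedy _; apply: greedy => //.
by apply/poly_independent_rcons => //; apply: ltnW.
Qed.

Let sol_comb c : pencil_solution A B (\sum_(i < k) c i *: X`_i).
Proof.
rewrite /pencil_solution mulmx_sumr big1 // => i _.
by rewrite -scalemxAr X_sol ?scaler0 // mem_nth.
Qed.

Lemma minimal_solution_sorted i j : (i <= j)%N -> (j < k)%N -> (eps i <= eps j)%N.
Proof.
move=> le_ij lt_jk; have lt_ik := leq_ltn_trans le_ij lt_jk.
apply: X_greedy => // [|c b cb0]; first by apply/X_sol/mem_nth.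
pose e l := (if (l < i)%N then c l else 0) + (if l == j then b else 0).
have e0 : forall l, (l < k)%N -> e l = 0.
  apply: X_ind; under eq_bigr do rewrite scalerDl.
  rewrite big_split /= -[RHS]cb0; congr (_ + _).
    rewrite (big_ord_widen k (fun l => c l *: X`_l)) 1?ltnW // [RHS]big_mkcond.
    by apply: eq_bigr => l _; case: ifP; rewrite ?scale0r.
  rewrite (bigD1 (Ordinal lt_jk)) //= eqxx big1 ?addr0 // => l l_nj.
  by rewrite ifN ?scale0r.
split=> [|l lt_l].
  by have := e0 j lt_jk; rewrite /e eqxx ltnNge le_ij add0r.
have := e0 l (ltn_trans lt_l lt_ik).
by rewrite /e lt_l ltn_eqF ?addr0 // (leq_trans lt_l).
Qed.

(** The form in which the greedy choice is used: z and X`_j are interchangeable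
    modulo the earlier solutions, so z was a candidate for the j-th choice and
    cannot have smaller degree.  With a bound on sizes rather than on the degree,
    the case d = 0 is refuted as well. *)
Lemma minimal_solution_lt z q c j d :
  pencil_solution A B z -> q != 0 -> q *: z = \sum_(i < k) c i *: X`_i ->
  (j < k)%N -> c j != 0 -> (forall i, (j < i < k)%N -> c i = 0) ->
  (forall r, (size (z r ord0) <= d)%N) -> (eps j < d)%N.
Proof.
move=> zsol q_n0 zE lt_jk cj_n0 c0 size_z.
have z_n0 : z != 0.
  apply: contraNneq cj_n0 => z0; apply/eqP; apply: X_ind lt_jk.
  by rewrite -zE z0 scaler0.
have [r zr_n0] : exists r, z r ord0 != 0.
  apply: contrapT => /forallNP z0; case/eqP: z_n0; apply/colP => r.
  by have /negP := z0 r; rewrite negbK mxE => /eqP.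
have d_gt0 : (0 < d)%N by apply: leq_trans (size_z r); rewrite size_poly_gt0.
apply: leq_ltn_trans (_ : vec_degree z < d)%N; last first.
  rewrite -(prednK d_gt0) ltnS; apply/bigmax_leqP => i _.
  by have := size_z i; lia.
apply: X_greedy => // a b ab0.
(* q times the relation, with q z replaced by its expression *)
pose e i := b * c i + (if (i < j)%N then q * a i else 0).
have e0 : forall i, (i < k)%N -> e i = 0.
  apply: X_ind; under eq_bigr do rewrite scalerDl -scalerA.
  rewrite big_split /= -scaler_sumr -zE scalerA mulrC -scalerA -[RHS](scaler0 _ q).
  rewrite -[in RHS]ab0 scalerDr addrC; congr (_ + _).
  rewrite (big_ord_widen k (fun l => a l *: X`_l)) 1?ltnW // scaler_sumr.
  rewrite [RHS]big_mkcond.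
  by apply: eq_bigr => l _; case: ifP; rewrite ?scale0r ?scalerA.
have b0 : b = 0.
  have /eqP := e0 j lt_jk; rewrite /e ltnn addr0 mulf_eq0 (negPf cj_n0) orbF.
  by move/eqP.
split=> // i lt_i; have /eqP := e0 i (ltn_trans lt_i lt_jk).
by rewrite /e lt_i b0 mul0r add0r mulf_eq0 (negPf q_n0) => /eqP.
Qed.

Lemma minimal_solution_frac z : pencil_solution A B z ->
  exists2 q : {poly K}, q != 0 & exists c, q *: z = \sum_(i < k) c i *: X`_i.
Proof.
move=> zsol; apply: contrapT => noq; case: minX => _ _ _ /(_ z zsol); apply.
rewrite -[X]take_size; apply/poly_independent_rcons => // c b cb0.
have b0 : b = 0.
  apply: contrapT => /eqP b_n0; apply: noq; exists b => //.
  exists (fun i => - c i); under eq_bigr do rewrite scaleNr.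
  by rewrite sumrN; apply/eqP; rewrite -addr_eq0 addrC cb0.
by move: cb0; rewrite b0 scale0r addr0 => /X_ind.
Qed.

Lemma last_nonzero c : (exists2 i, (i < k)%N & c i != 0) ->
  exists j, [/\ (j < k)%N, c j != 0 & forall i, (j < i < k)%N -> c i = 0].
Proof.
move=> [i0 lt_i0 c_i0]; pose P i := (i < k)%N && (c i != 0).
have exP : exists i, P i by exists i0; rewrite /P lt_i0.
have ubP i : P i -> (i <= k)%N by case/andP => /ltnW.
have [j /andP [lt_j cj] jmax] := ex_maxnP exP ubP.
exists j; split=> // i /andP [lt_ji lt_ik]; apply/eqP; apply: contraLR lt_ji => ci.
by rewrite -leqNgt; apply: jmax; rewrite /P lt_ik.
Qed.

(** Write q z as a combination and reduce its coefficients modulo q.  If a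
    remainder were nonzero, the last one would exhibit a solution of degree less
    than that of the corresponding X`_j. *)
Lemma minimal_solutions_generate z : pencil_solution A B z ->
  exists c, z = \sum_(i < k) c i *: X`_i.
Proof.
move=> zsol; have [q q_n0 [c zE]] := minimal_solution_frac zsol.
pose z' := z - \sum_(i < k) (c i %/ q) *: X`_i.
have z'sol : pencil_solution A B z'.
  have := sol_comb (fun i => c i %/ q); rewrite /pencil_solution => comb0.
  by rewrite mulmxBr zsol comb0 subrr.
have z'E : q *: z' = \sum_(i < k) (c i %% q) *: X`_i.
  rewrite scalerBr zE scaler_sumr -sumrB; apply: eq_bigr => i _.
  by rewrite scalerA -scalerBl {1}(divp_eq (c i) q) [q * _]mulrC addrAC subrr add0r.
suff z'0 : z' = 0.
  by exists (fun i => c i %/ q); apply/eqP; rewrite -subr_eq0; apply/eqP.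
apply: contrapT => /eqP z'_n0.
have [|j [lt_jk cj_n0 cj_max]] := @last_nonzero (fun i => c i %% q).
  apply: contrapT => noi; case/eqP: z'_n0; apply/eqP.
  have /eqP : q *: z' = 0.
    rewrite z'E big1 // => i _; have [->|ci] := eqVneq (c i %% q) 0.
      by rewrite scale0r.
    by case: noi; exists i.
  by rewrite scalemx_eq0 (negPf q_n0) => /eqP ->.
suff: (eps j < eps j)%N by rewrite ltnn.
apply: (minimal_solution_lt z'sol q_n0 z'E lt_jk cj_n0 cj_max) => r.
have [->|z'r_n0] := eqVneq (z' r ord0) 0; first by rewrite size_poly0.
suff: (size (q * z' r ord0)%R <= (size q).-1 + eps j)%N.
  rewrite size_mul //; move: q_n0; rewrite -size_poly_gt0.
  move: (size q) (size (z' r ord0)) (eps j) => a b e; lia.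
have -> : q * z' r ord0 = (q *: z') r ord0 by rewrite [RHS]mxE.
rewrite z'E summxE; apply: leq_trans (size_sum _ _ _) _.
apply/bigmax_leqP => i _; rewrite mxE.
have [le_ij|lt_ji] := leqP i j; last first.
  by rewrite cj_max ?lt_ji ?ltn_ord // mul0r size_poly0.
have := minimal_solution_sorted le_ij lt_jk.
have := size_vec_degree (X`_i) r; rewrite -/(eps i).
have : (size (c i %% q)%R < size q)%N by rewrite ltn_modp.
have := size_polyMleq (c i %% q) (X`_i r ord0).
move: (size (c i %% q)%R) (size q) (size (c i %% q * X`_i r ord0)%R) (size
  (X`_i r ord0)) (eps i) (eps j) => *; lia.
Qed.

(** The leading terms of the c i *: X`_i cannot cancel: a relation between the
    leading coefficient vectors of the X`_i would, multiplied by suitable powers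
    of the variable, produce a solution of degree below the largest index
    involved. *)
Lemma minimal_solutions_degree c d :
  (forall r, (size ((\sum_(i < k) c i *: X`_i)%R r ord0) <= d)%N) ->
  forall i, (i < k)%N -> (size (c i) <= d - eps i)%N.
Proof.
move=> size_z i0 lt_i0; apply: contrapT => /negP; rewrite -ltnNge => bad.
(* D is one more than the largest degree of a term c i *: X`_i, and j below is the
   last index attaining it; a i is the leading coefficient of such a c i, and 0
   for the other terms. *)
pose P D := [exists i : 'I_k, (c i != 0) && (size (c i) + eps i == D)%N].
have c_i0 : c i0 != 0 by rewrite -size_poly_gt0; lia.
have exP : exists D, P D.
  exists (size (c i0) + eps i0)%N; apply/existsP; exists (Ordinal lt_i0).
  by rewrite c_i0 /=.
have ubP D : P D -> (D <= \sum_(i < k) (size (c i) + eps i))%N.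
  by move=> /existsP [i /andP [_ /eqP <-]]; rewrite (bigD1 i) //= leq_addr.
have [D /existsP [i1 /andP [ci1 /eqP i1D]] Dmax] := ex_maxnP exP ubP.
have leD i : (i < k)%N -> c i != 0 -> (size (c i) + eps i <= D)%N.
  move=> lt_i ci; apply: Dmax; apply/existsP; exists (Ordinal lt_i).
  by rewrite ci /=.
have lt_dD : (d < D)%N by have := leD i0 lt_i0 c_i0; lia.
pose a i := (c i)`_(D.-1 - eps i).
have [|j [lt_jk aj_n0 aj_max]] := @last_nonzero (fun i => (a i)%:P).
  exists i1 => //; rewrite polyC_eq0 /a.
  have -> : (D.-1 - eps i1)%N = (size (c i1)).-1 by have := ci1;
    rewrite -size_poly_gt0; lia.
  by rewrite -lead_coefE lead_coef_eq0.
rewrite polyC_eq0 in aj_n0.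
have a0 i : (j < i < k)%N -> a i = 0.
  by move=> /aj_max /eqP; rewrite polyC_eq0 => /eqP.
pose e i := if (i <= j)%N then a i *: 'X^(eps j - eps i) else 0.
suff: (eps j < eps j)%N by rewrite ltnn.
apply: (@minimal_solution_lt (\sum_(i < k) e i *: X`_i) 1 e) => //.
- exact: oner_neq0.
- by rewrite scale1r.
- by rewrite /e leqnn subnn expr0 scaler_eq0 negb_or aj_n0 oner_neq0.
- by move=> i /andP [lt_ji _]; rewrite /e leqNgt lt_ji.
move=> r; rewrite summxE.
have size_e (i : 'I_k) : (size ((e i *: X`_i)%R r ord0) <= (eps j).+1)%N.
  rewrite mxE /e. case: (leqP i j) => [le_ij|_]; last by rewrite mul0r size_poly0.
  have := minimal_solution_sorted le_ij lt_jk.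
  have := size_vec_degree (X`_i) r; rewrite -/(eps i).
  have := size_scale_leq (a i) 'X^(eps j - eps i); rewrite size_polyXn.
  move=> s1 s2 s3; apply: leq_trans (size_polyMleq _ _) _; move: s1 s2 s3.
  move: (size (a i *: 'X^(eps j - eps i))%R) (size (X`_i r ord0)) (eps i) (eps j).
  lia.
apply/leq_sizeP => l; rewrite leq_eqVlt => /orP [/eqP <-|lt_l]; last first.
  apply: nth_default; apply: leq_trans (size_sum _ _ _) _.
  by apply/bigmax_leqP => i _; apply: leq_trans (size_e i) _.
transitivity ((\sum_(i < k) (c i *: X`_i) r ord0)`_D.-1); last first.
  by rewrite -summxE nth_default //; apply: leq_trans (size_z r) _; lia.
rewrite !coef_sum; apply: eq_bigr => i _; rewrite !mxE.
have size_x := size_vec_degree (X`_i) r.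
transitivity (a i * (X`_i r ord0)`_(eps i)).
  rewrite /e; case: (leqP i j) => [le_ij|lt_ji];
    last by rewrite a0 ?lt_ji ?ltn_ord // !mul0r coef0.
  have le_eps := minimal_solution_sorted le_ij lt_jk.
  by rewrite -scalerAl coefZ coefXnM ltnNge leq_subr /= subKn.
have [ci0|ci] := eqVneq (c i) 0; first by rewrite /a ci0 coef0 !mul0r coef0.
have le_D := leD i (ltn_ord i) ci.
have -> : D.-1 = (D.-1 - eps i + eps i)%N by have := ci;
  rewrite -size_poly_gt0; lia.
by rewrite coefM_top ?addnK //; have := ci; rewrite -size_poly_gt0; lia.
Qed.

Hypotheses (skewA : A^T = - A) (skewB : B^T = - B).

Lemma pencil_solution_tr (z : 'rV[{poly K}]_n) :
  pencil_solution A B z^T <-> z *m lpencil A B = 0.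
Proof.
have -> : z *m lpencil A B = - ((map_mx polyC A + 'X *: map_mx polyC B) *m z^T)^T.
  have MT : (lpencil A B)^T = - lpencil A B.
    rewrite /lpencil [LHS]linearD /= [('X *: _)^T]linearZ /= !map_trmx skewA skewB.
    by rewrite !map_mxN scalerN -opprD.
  by rewrite -/(lpencil A B) trmx_mul trmxK MT mulmxN opprK.
rewrite /pencil_solution; split=> [->|/eqP]; first by rewrite trmx0 oppr0.
by rewrite oppr_eq0 trmx_eq0 => /eqP.
Qed.

(** The solutions of bounded degree are coordinatized by coefficients c i of
    size at most d - eps i. *)
Lemma polydim_row_sol d :
  polydim (row_sol A B d) (\sum_(e <- [seq vec_degree z | z <- X]) (d - e)).
Proof.
pose XM : 'M[{poly K}]_(k, n) := \matrix_(i, r) X`_i r ord0.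
pose comb (c : 'rV[{poly K}]_k) i : {poly K} := if insub i is Some j then c
  ord0 j else 0.
have combE (c : 'rV[{poly K}]_k) (j : 'I_k) : comb c j = c ord0 j by rewrite
  /comb valK.
have XME (c : 'rV[{poly K}]_k) : c *m XM = (\sum_(i < k) comb c i *: X`_i)^T.
  apply/rowP => r; rewrite mxE [RHS]mxE summxE; apply: eq_bigr => i _.
  by rewrite !mxE combE.
rewrite big_map (big_nth 0%R) big_mkord.
have := polydim_box K (fun i : 'I_k => d - eps i)%N.
move=> /(@polydim_klin _ k n _ _ (fun c : 'rV[{poly K}]_k => c *m XM));
  set P := (X in polydim X).
move=> dimP; apply: polydim_ext (dimP _ _) => [z|a u v|c _ c0]; last 2 first.
- by rewrite mulmxDl scalemxAl.
- apply/rowP => j; rewrite mxE -combE; apply: X_ind (ltn_ord j).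
  by apply: trmx_inj; rewrite -XME c0 trmx0.
split=> [[c size_c ->]|[zsol size_z]].
  split; first by apply/pencil_solution_tr; rewrite XME trmxK; apply: sol_comb.
  move=> r; rewrite mxE; apply: leq_trans (size_sum _ _ _) _.
  apply/bigmax_leqP => i _; have := size_c i; rewrite mxE.
  have := size_polyMleq (c ord0 i) (X`_i r ord0).
  have := size_vec_degree (X`_i) r; rewrite -/(eps i).
  have [->|] := eqVneq (c ord0 i) 0; first by rewrite mul0r size_poly0.
  rewrite -size_poly_gt0.
  move: (size (c ord0 i)) (size (X`_i r ord0)) (size (c ord0 i * X`_i r
    ord0)%R) (eps i).
  lia.
have [c zE] := minimal_solutions_generate ((pencil_solution_tr z).2 zsol).
exists (\row_i c i).
  move=> i; rewrite mxE; apply: minimal_solutions_degree (ltn_ord i) => r.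
  by rewrite -zE mxE.
apply: trmx_inj; rewrite XME trmxK zE; apply: eq_bigr => i _.
by rewrite combE mxE.
Qed.

End MinimalSolutions.

(** * Homogenization of polynomials and of determinants *)

Section DeterminantDegree.
Local Open Scope ring_scope.
Variable K : fieldType.

Lemma prod_top m (p : 'I_m -> {poly K}) d :
  (forall i, (size (p i) <= d.+1)%N) ->
  (size (\prod_i p i)%R <= (m * d).+1)%N /\
  (\prod_i p i)`_(m * d) = \prod_i (p i)`_d.
Proof.
elim: m p => [|m IHm] p size_p.
  by rewrite !big_ord0 size_poly1 coef1.
have [sz top] := IHm (fun i => p (lift ord0 i)) (fun i => size_p _).
rewrite !big_ord_recl mulSn coefM_top // top; split=> //.
apply: leq_trans (size_polyMleq _ _) _; have := size_p ord0; move: sz.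
move: (size (p ord0)) (size (\prod_(i < m) p (lift ord0 i))%R) => a b; lia.
Qed.

(** In the Leibniz expansion, degree m * d is reached only by taking the
    coefficient of degree d in every factor. *)
Lemma det_top m (Q : 'M[{poly K}]_m) d :
  (forall i j, (size (Q i j) <= d.+1)%N) ->
  (size (\det Q) <= (m * d).+1)%N /\
  (\det Q)`_(m * d) = \det (map_mx (fun p : {poly K} => p`_d) Q).
Proof.
move=> size_Q; have size_prod (s : 'S_m) := prod_top (fun i => size_Q i (s i)).
split.
  apply: leq_trans (size_sum _ _ _) _; apply/bigmax_leqP => s _.
  by rewrite mulr_sign; case: ifP; rewrite ?size_polyN; case: (size_prod s).
rewrite coef_sum; apply: eq_bigr => s _.
rewrite !mulr_sign; under [in RHS]eq_bigr do rewrite mxE.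
by case: ifP => _; rewrite ?coefN (proj2 (size_prod s)).
Qed.

End DeterminantDegree.

Section Homogenization.
Local Open Scope ring_scope.
Variables (K : fieldType) (S : idomainType) (iota : {rmorphism K -> S}) (u v : S).

Local Notation "x %:F" := (tofrac x).

(** v ^+ m times the value of f at u / v, written without denominators. *)
Definition homog m (f : {poly K}) : S :=
  \sum_(i < m.+1) iota f`_i * u ^+ i * v ^+ (m - i).

(** Identities about [homog] are checked in the fraction field, where it becomes
    v ^+ m times this ring morphism. *)
Definition frac_eval : {rmorphism {poly K} -> {fraction S}} :=
  horner_eval (u%:F / v%:F) \o map_poly (@tofrac S \o iota).

Lemma frac_evalE (f : {poly K}) m : (size f <= m)%N ->
  frac_eval f = \sum_(i < m) (iota f`_i)%:F * (u%:F / v%:F) ^+ i.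
Proof.
move=> size_f; rewrite /= /horner_eval.
rewrite (@horner_coef_wide _ m); last by apply: leq_trans (size_poly _ _) size_f.
by apply: eq_bigr => i _; rewrite coef_map.
Qed.

Lemma frac_evalC a : frac_eval a%:P = (iota a)%:F.
Proof. by rewrite /= /horner_eval map_polyC hornerC. Qed.

Lemma frac_evalX : frac_eval 'X = u%:F / v%:F.
Proof. by rewrite /= /horner_eval map_polyX hornerX. Qed.

Hypothesis v_n0 : v != 0.

Let vF_n0 : v%:F != 0. Proof. by rewrite tofrac_eq0. Qed.

Lemma tofrac_homog m (f : {poly K}) : (size f <= m.+1)%N ->
  (homog m f)%:F = v%:F ^+ m * frac_eval f.
Proof.
move=> size_f; rewrite (frac_evalE size_f) mulr_sumr rmorph_sum;
  apply: eq_bigr => i _.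
have le_im : (i <= m)%N by rewrite -ltnS.
have -> : v%:F ^+ m = v%:F ^+ (m - i) * v%:F ^+ i by rewrite -exprD subnK.
rewrite !rmorphM !rmorphXn /= expr_div_n mulrACA [X in _ = _ * X]mulrCA.
by rewrite mulfV ?expf_neq0 // mulr1 -[RHS]mulrA [RHS]mulrC.
Qed.

Lemma homogM a b (f g : {poly K}) : (size f <= a.+1)%N -> (size g <= b.+1)%N ->
  homog (a + b) (f * g) = homog a f * homog b g.
Proof.
move=> sf sg; apply/eqP; rewrite -tofrac_eq tofracM !tofrac_homog //.
  by rewrite rmorphM exprD mulrACA.
apply: leq_trans (size_polyMleq _ _) _; move: sf sg.
move: (size f) (size g); lia.
Qed.

Lemma tofrac_pencil n (A B : 'M[K]_n) :
  map_mx (@tofrac S) (v *: map_mx iota A + u *: map_mx iota B)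
  = v%:F *: map_mx frac_eval (lpencil A B).
Proof.
apply/matrixP => i j; rewrite !mxE (rmorphD frac_eval) (rmorphM frac_eval).
rewrite !frac_evalC frac_evalX tofracD !tofracM mulrDr; congr (_ + _).
by rewrite mulrA [X in _ = X * _]mulrC divfK.
Qed.

Lemma det_homog m (A B : 'M[K]_m) :
  \det (v *: map_mx iota A + u *: map_mx iota B) = homog m (\det (lpencil A B)).
Proof.
apply/eqP; rewrite -tofrac_eq -det_map_mx tofrac_pencil detZ det_map_mx.
rewrite tofrac_homog //.
have [|sz _] := @det_top K m (lpencil A B) 1; last by rewrite muln1 in sz.
move=> i j; rewrite !mxE; apply: leq_trans (size_polyD _ _) _.
rewrite geq_max (leq_trans (size_polyC_leq1 _)) //=.
apply: leq_trans (size_polyMleq _ _) _; rewrite size_polyX.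
by have := size_polyC_leq1 (B i j); case: size => [|[]].
Qed.

End Homogenization.

(** * Change of the affine coordinate of a pencil *)

Section PolydimSub.
Local Open Scope ring_scope.
Variables (K : fieldType) (n : nat).

Lemma polydim_sub (P P' : 'rV[{poly K}]_n -> Prop) m' :
  P 0 -> (forall a u v, P u -> P v -> P (a%:P *: u + v)) ->
  (forall z, P z -> P' z) -> polydim P' m' -> exists m, polydim P m.
Proof.
move=> P0 Plin PP' [Q inj PQ].
pose U := subspace_of (fun v : 'rV[K]_m' => P (map_mx polyC v *m Q)).
have UP v : v \in U <-> P (map_mx polyC v *m Q).
  apply: mem_subspace_of => [|a u w Pu Pw]; first by rewrite map_mx0 mul0mx.
  by rewrite map_mxD map_mxZ mulmxDl -scalemxAl; apply: Plin.
exists (\dim U).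
have := @polydim_vspace K n _ U (fun v => map_mx polyC v *m Q).
move=> dimU; apply: polydim_ext (dimU _ _) => [z|a u v|v _]; last exact: inj.
  split=> [[v /UP ? ->] //|Pz]; have /PQ [v zE] := PP' _ Pz.
  by exists v => //; apply/UP; rewrite -zE.
by rewrite map_mxD map_mxZ mulmxDl -scalemxAl.
Qed.

Lemma polydim_row_sol_exists (A B : 'M[K]_n) d : exists m, polydim (row_sol A B
  d) m.
Proof.
apply: (polydim_sub _ _ _ (polydim_box K (fun _ : 'I_n => d))) => [|a u v|z [] //].
  by split=> [|i]; rewrite ?mul0mx // mxE size_poly0.
move=> [u0 size_u] [v0 size_v]; split=> [|i].
  by rewrite mulmxDl -scalemxAl u0 v0 scaler0 addr0.
rewrite !mxE mul_polyC; apply: leq_trans (size_polyD _ _) _.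
by rewrite geq_max size_v (leq_trans (size_scale_leq _ _)).
Qed.

End PolydimSub.

Lemma map_tofrac_eq0 (S : idomainType) m n (M : 'M[S]_(m, n)) :
  map_mx (@tofrac S) M = 0%R -> M = 0%R.
Proof.
move=> /matrixP M0; apply/matrixP => i j; have := M0 i j; rewrite !mxE => /eqP.
by rewrite tofrac_eq0 => /eqP.
Qed.

Section Chart.
Local Open Scope ring_scope.
Variables (K : fieldType) (n : nat) (A B : 'M[K]_n) (c : K).

Let v : {poly K} := 1 + c *: 'X.

Let v_n0 : v != 0.
Proof.
apply/eqP => /(congr1 (fun p : {poly K} => p.[0])).
by rewrite !hornerE ?mulr0 ?addr0 => /eqP; rewrite oner_eq0.
Qed.

Local Notation hom := (homog polyC 'X v).

Lemma homog_chart_eq0 m (f : {poly K}) : (size f <= m.+1)%N -> hom m f = 0 -> f = 0.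
Proof.
elim: m f => [|m IHm] f size_f.
  by rewrite /homog big_ord1 !expr0 !mulr1 => /eqP;
    rewrite polyC_eq0 [f]size1_polyC // coefC => /eqP ->.
move=> hom0; have f0 : f`_0 = 0.
  have := congr1 (fun p : {poly K} => p.[0]) hom0.
  rewrite /homog horner_sum big_ord_recl big1 => [|i _]; last first.
    by rewrite !hornerE exprS ?mul0r ?mulr0 ?mul0r.
  by rewrite !hornerE ?mulr0 ?addr0 ?expr1n ?mulr1.
have fE : f = (f %/ 'X) * 'X.
  by apply/esym/divpK; rewrite -['X]subr0 dvdp_XsubCl /root horner_coef0 f0.
have size_fX : (size (f %/ 'X)%R <= m.+1)%N.
  by rewrite size_divp ?polyX_eq0 // size_polyX leq_subLR add1n.
have homX : hom 1 'X = 'X.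
  by rewrite /homog !big_ord_recl big_ord0 /= !coefX mul0r mul0r add0r addr0
    expr1 expr0 mul1r mulr1.
move: hom0; rewrite fE -addn1 homogM ?size_polyX // homX => /eqP.
by rewrite mulf_eq0 polyX_eq0 orbF => /eqP /IHm -> //; rewrite mul0r.
Qed.

Lemma size_hom d f : (size (hom d f) <= d.+1)%N.
Proof.
apply: leq_trans (size_sum _ _ _) _; apply/bigmax_leqP => j _.
rewrite -mulrA mul_polyC; apply: leq_trans (size_scale_leq _ _) _.
have size_v : (size v <= 2)%N.
  apply: leq_trans (size_polyD _ _) _; rewrite size_poly1 geq_max /=.
  by apply: leq_trans (size_scale_leq _ _) _; rewrite size_polyX.
apply: leq_trans (size_polyMleq _ _) _; rewrite size_polyXn addSn /=.
apply: (@leq_trans (j + (d - j).+1)); last by have := ltn_ord j; lia.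
rewrite leq_add2l; apply: leq_trans (size_poly_exp_leq _ _) _.
rewrite ltnS -[X in (_ <= X)%N]mul1n leq_mul2r; apply/orP; right.
by move: size_v; case: (size v) => [|[|[]]].
Qed.

(** A solution z of A + t B of degree at most e gives the solution
    (1 + c t)^e z(t / (1 + c t)) of A + t (B + c A). *)
Lemma row_sol_chart_le d m m' :
  polydim (row_sol A B d) m -> polydim (row_sol A (B + c *: A) d) m' -> (m <= m')%N.
Proof.
case: d => [|d] dimAB dimAB'.
  apply: polydim_le dimAB dimAB' => z [_ size_z].
  have -> : z = 0 by apply/rowP => i; rewrite mxE; apply/eqP;
    rewrite -size_poly_leq0.
  by split=> [|i]; rewrite ?mul0mx // mxE size_poly0.
pose f (z : 'rV[{poly K}]_n) := \row_i hom d (z 0 i).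
have := @polydim_klin K n n _ _ f _ _ dimAB => dimf.
apply: polydim_le (dimf _ _) dimAB' => [_ [z [zsol size_z] ->]|a u w|z [_
  size_z] fz0].
- split=> [|i]; last by rewrite mxE size_hom.
  apply: map_tofrac_eq0; rewrite map_mxM.
  have -> : lpencil A (B + c *: A) = v *: map_mx polyC A + 'X *: map_mx polyC B.
    rewrite /lpencil map_mxD map_mxZ scalerDr scalerA scalerDl scale1r -!addrA.
    by congr (_ + _); rewrite addrC mulrC mul_polyC.
  have -> : map_mx (@tofrac _) (f z) = tofrac v ^+ d *: map_mx (frac_eval polyC
    'X v) z.
    by apply/rowP => i; rewrite mxE [f z _ _]mxE [RHS]mxE [X in _ * X]mxE
      tofrac_homog.
  by rewrite tofrac_pencil // -scalemxAl -scalemxAr -map_mxM zsol map_mx0 !scaler0.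
- apply/rowP => i; rewrite !mxE /homog mulr_sumr -big_split;
  apply: eq_bigr => j _ /=.
  by rewrite coefD mul_polyC coefZ polyCD polyCM !mulrDl !mulrA.
apply/rowP => i; rewrite mxE; apply: (@homog_chart_eq0 d) => //.
by have := congr1 (fun w : 'rV[{poly K}]_n => w 0 i) fz0; rewrite !mxE.
Qed.

End Chart.

Section Dehomogenization.
Local Open Scope ring_scope.
Variables (K : fieldType).

Lemma row_sol_chart n (A B : 'M[K]_n) c d m :
  polydim (row_sol A B d) m -> polydim (row_sol A (B + c *: A) d) m.
Proof.
move=> dimAB; have [m' dimAB'] := polydim_row_sol_exists A (B + c *: A) d.
suff -> : m = m' by [].
apply/eqP; rewrite eqn_leq (row_sol_chart_le dimAB dimAB').
have dimAB2 : polydim (row_sol A (B + c *: A + (- c) *: A) d) m.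
  by rewrite scaleNr addrK.
exact: row_sol_chart_le dimAB' dimAB2.
Qed.

Variable c : K.

(** The linear form that becomes constant in the chosen affine coordinate. *)
Definition ell : {poly {poly K}} := mu K - cst c * lam K.

Fact dehomog_key : unit. Proof. by []. Qed.

(** Evaluation at lambda = t, mu = 1 + c t.  Its body is locked so that rewriting
    with the ring morphism laws does not unfold it. *)
Definition dehomog : {poly {poly K}} -> {poly K} :=
  locked_with dehomog_key (horner_eval 'X \o map_poly (comp_poly (1 + c *: 'X))).

Lemma dehomogE p : dehomog p = (map_poly (comp_poly (1 + c *: 'X)) p).['X].
Proof. by rewrite /dehomog unlock. Qed.

Fact dehomog_is_zmod_morphism : zmod_morphism dehomog.
Proof. by move=> p q; rewrite /dehomog unlock rmorphB. Qed.

Fact dehomog_is_monoid_morphism : monoid_morphism dehomog.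
Proof. by split=> [|p q]; rewrite /dehomog unlock ?rmorph1 ?rmorphM. Qed.

HB.instance Definition _ :=
  GRing.isZmodMorphism.Build _ _ dehomog dehomog_is_zmod_morphism.
HB.instance Definition _ :=
  GRing.isMonoidMorphism.Build _ _ dehomog dehomog_is_monoid_morphism.

Lemma dehomogC a : dehomog (cst a) = a%:P.
Proof. by rewrite dehomogE /cst map_polyC hornerC /= comp_polyC. Qed.

Lemma dehomog_lam : dehomog (lam K) = 'X.
Proof. by rewrite dehomogE /lam map_polyX hornerX. Qed.

Lemma dehomog_mu : dehomog (mu K) = 1 + c *: 'X.
Proof. by rewrite dehomogE /mu map_polyC hornerC /= comp_polyX. Qed.

Lemma dehomog_ell : dehomog ell = 1.
Proof.
rewrite /ell rmorphB rmorphM /= dehomog_mu dehomogC dehomog_lam mul_polyC.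
by rewrite addrK.
Qed.

Lemma ell_neq0 : ell != 0.
Proof.
apply: contraTneq (oner_neq0 {poly K}) => ell0.
by rewrite -dehomog_ell ell0 rmorph0 eqxx.
Qed.

Definition cst_morph : {rmorphism K -> {poly {poly K}}} := polyC \o polyC.

Local Notation iota := cst_morph.
Local Notation hom := (homog iota (lam K) ell).

Lemma dehomogK m (f : {poly K}) : (size f <= m.+1)%N -> dehomog (hom m f) = f.
Proof.
move=> size_f; rewrite /homog rmorph_sum.
rewrite -[RHS]coefK poly_def -(big_mkord xpredT (fun i => f`_i *: 'X^i)).
transitivity (\sum_(i < m.+1) f`_i *: 'X^i).
  apply: eq_bigr => i _; rewrite !rmorphM !rmorphXn /= dehomog_ell dehomog_lam.
  by rewrite expr1n mulr1 (dehomogC f`_i) mul_polyC.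
rewrite -(big_mkord xpredT (fun i => f`_i *: 'X^i)) (big_cat_nat (leq0n _)
  size_f) /=.
rewrite [X in _ + X]big_nat_cond [X in _ + X]big1 ?addr0 // => i /andP [/andP
  [le_i _] _].
by rewrite nth_default // scale0r.
Qed.

Lemma pencil_ell n (A B : 'M[K]_n) :
  pencil A B = ell *: map_mx iota A + lam K *: map_mx iota (B + c *: A).
Proof.
apply/matrixP => i j; rewrite !mxE /= /ell /cst polyCD polyCM polyCD polyCM.
ring.
Qed.

Lemma minor_homog n (A B : 'M[K]_n) m (h k : 'I_m -> 'I_n) :
  \det (mxsub h k (pencil A B))
  = hom m (\det (mxsub h k (lpencil A (B + c *: A)))).
Proof.
rewrite pencil_ell; set B' := B + _.
have -> : mxsub h k (lpencil A B') = lpencil (mxsub h k A) (mxsub h k B').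
  by apply/matrixP => i j; rewrite !mxE.
rewrite -(det_homog _ _ ell_neq0); congr (\det _).
by apply/matrixP => i j; rewrite !mxE.
Qed.

Lemma dehomog_minor n (A B : 'M[K]_n) m (h k : 'I_m -> 'I_n) :
  dehomog (\det (mxsub h k (pencil A B)))
  = \det (mxsub h k (lpencil A (B + c *: A))).
Proof.
rewrite -det_map_mx; congr (\det _); apply/matrixP => i j.
rewrite !mxE rmorphD !rmorphM /= dehomog_mu dehomog_lam !dehomogC.
rewrite polyCD polyCM -!mul_polyC.
ring.
Qed.

Lemma size_det_lpencil m (A B : 'M[K]_m) : (size (\det (lpencil A B)) <= m.+1)%N.
Proof.
have [|sz _] := @det_top K m (lpencil A B) 1; last by rewrite muln1 in sz.
move=> i j; rewrite !mxE; apply: leq_trans (size_polyD _ _) _.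
rewrite geq_max (leq_trans (size_polyC_leq1 _)) //=.
apply: leq_trans (size_polyMleq _ _) _; rewrite size_polyX.
by have := size_polyC_leq1 (B i j); case: size => [|[]].
Qed.

End Dehomogenization.

(** * Minors of a Smith normal form *)

Section CauchyBinet.
Local Open Scope ring_scope.

(** Half of the Cauchy-Binet formula: it suffices for divisibility statements,
    where minors with repeated or permuted rows do no harm. *)
Lemma det_mulmx_rows (R : comNzRingType) m n (L : 'M[R]_(m, n)) (N : 'M[R]_(n, m)) :
  \det (L *m N)
  = \sum_(f : {ffun 'I_m -> 'I_n}) (\prod_i L i (f i)) * \det (rowsub f N).
Proof.
rewrite /determinant.
transitivity (\sum_(s : 'S_m) \sum_(f : {ffun 'I_m -> 'I_n})
    (-1) ^+ s * \prod_i (L i (f i) * N (f i) (s i))).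
  apply: eq_bigr => s _; rewrite -mulr_sumr; congr (_ * _).
  rewrite -(bigA_distr_bigA (fun i j => L i j * N j (s i))).
  by apply: eq_bigr => i _; rewrite mxE.
rewrite exchange_big; apply: eq_bigr => f _; rewrite mulr_sumr.
apply: eq_bigr => s _; rewrite big_split /= mulrCA; congr (_ * (_ * _)).
by apply: eq_bigr => i _; rewrite mxE.
Qed.

Lemma det_rowsub_noninj (R : comNzRingType) m n (f : 'I_m -> 'I_n) (N :
  'M[R]_(n, m)) :
  ~ injective f -> \det (rowsub f N) = 0.
Proof.
move/injectiveP/injectivePn => [x [y neq_xy eq_f]].
by apply: (determinant_alternate neq_xy) => j; rewrite !mxE eq_f.
Qed.

Lemma increasing_sort m n (f : 'I_m -> 'I_n) : injective f ->
  exists2 h : 'I_m -> 'I_n, {homo h : i j / (i < j)%N} &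
    exists s : 'S_m, forall i, f i = h (s i).
Proof.
move=> f_inj; pose A := [set f i | i : 'I_m].
have cardA : #|A| = m by rewrite card_imset // card_ord.
have fA i : f i \in A by apply: imset_f.
pose h (i : 'I_m) : 'I_n := enum_val (cast_ord (esym cardA) i).
exists h.
  move=> i j lt_ij; rewrite /h /enum_val.
  set x0 := enum_default _;
    rewrite (set_nth_default x0 (enum_default _)) -?cardE ?ltn_ord //.
  have tr : transitive (fun a b : 'I_n => (a < b)%N) by move=> ? ? ?;
    apply: ltn_trans.
  apply: (sorted_ltn_nth tr); rewrite ?inE -?cardE ?cardA ?ltn_ord //.
  rewrite /enum_mem; apply: sorted_filter => //.
  have := iota_ltn_sorted 0 n; rewrite -val_enum_ord sorted_map enumT; exact.
pose s i := cast_ord cardA (enum_rank_in (fA i) (f i)).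
have hs i : f i = h (s i).
  by rewrite /h /s cast_ordK enum_rankK_in.
have s_inj : injective s.
  by move=> i j eq_s; apply: f_inj; rewrite !hs eq_s.
by exists (perm s_inj) => i; rewrite permE.
Qed.

Lemma det_mxsub_perm (R : comNzRingType) m n (M : 'M[R]_n) (f g h k : 'I_m -> 'I_n)
    (s t : 'S_m) :
  (forall i, f i = h (s i)) -> (forall i, g i = k (t i)) ->
  \det (mxsub f g M) = (-1) ^+ s * (-1) ^+ t * \det (mxsub h k M).
Proof.
move=> fE gE; have -> : mxsub f g M = row_perm s (col_perm t (mxsub h k M)).
  by apply/matrixP => i j; rewrite !mxE fE gE.
rewrite row_permE col_permE !det_mulmx !det_perm odd_permV.
by rewrite -mulrA [\det _ * _]mulrC.
Qed.

End CauchyBinet.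

Section DeterminantalDivisors.
Local Open Scope ring_scope.
Variables (K : fieldType) (n : nat).
Implicit Types (d : 'rV[{poly K}]_n) (q : {poly K}).

Definition chain_prod d m : {poly K} := \prod_(i < n | (i < m)%N) d 0 i.

(** Compare the m indices of the image with the m smallest ones: those that
    differ can be matched, each being replaced by a larger index; d (m - 1)
    separates the two groups. *)
Lemma chain_prod_dvd d m (f : 'I_m -> 'I_n) : dvd_chain d -> injective f ->
  chain_prod d m %| \prod_i d 0 (f i).
Proof.
move=> chain f_inj; pose A := [set f i | i : 'I_m].
have cardA : #|A| = m by rewrite card_imset // card_ord.
have le_mn : (m <= n)%N by have := leq_card f f_inj; rewrite !card_ord.
pose I := [set i : 'I_n | (i < m)%N].
have cardI : #|I| = m.
  have w_inj : injective (widen_ord le_mn) by move=> i j /(congr1 val) /= ?;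
    apply: val_inj.
  rewrite -[RHS](card_ord m) -(card_imset _ w_inj).
  apply: eq_card => i; rewrite inE; apply/idP/imsetP => [lt_i|[j _ ->]];
    last exact: (ltn_ord j).
  by exists (Ordinal lt_i) => //; apply: val_inj.
have -> : \prod_i d 0 (f i) = \prod_(j in A) d 0 j.
  by rewrite big_imset //=; apply: in2W.
have -> : chain_prod d m = \prod_(j in I) d 0 j by apply: eq_bigl => i; rewrite inE.
rewrite (big_setID A) [X in _ %| X](big_setID I) /= setIC dvdp_mul //.
have cardD : #|A :\: I| = #|I :\: A|.
  by apply/eqP; rewrite -(eqn_add2l #|A :&: I|) cardsID setIC cardsID cardA cardI.
have [m0|m_gt0] := posnP m.
  have -> : I = set0 by apply/setP => i; rewrite !inE m0.
  by rewrite set0D big_set0 dvd1p.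
have lt_m : (m.-1 < n)%N by rewrite prednK.
pose g := d 0 (Ordinal lt_m).
apply: (@dvdp_trans _ (g ^+ #|I :\: A|)).
  rewrite -prodr_const;
    apply: (big_rec2 (fun x y : {poly K} => x %| y)) => [|i x y];
      first exact: dvdpp.
  rewrite !inE => /andP [_ lt_i] dvd_xy; apply: dvdp_mul => //.
  by apply: chain; rewrite /= -ltnS prednK.
rewrite -cardD -prodr_const;
  apply: (big_rec2 (fun x y : {poly K} => x %| y)) => [|i x y]; first exact: dvdpp.
rewrite !inE -leqNgt => /andP [le_i _] dvd_xy; apply: dvdp_mul => //.
by apply: chain; rewrite /= (leq_trans (leq_pred _)).
Qed.

Lemma dvdp_sum (I : finType) (F : I -> {poly K}) q :
  (forall i, q %| F i) -> q %| \sum_i F i.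
Proof. by move=> qF; apply: (big_ind (fun x => q %| x)) => [|x y|i _];
  [exact: dvdp0|exact: dvdp_add|exact: qF]. Qed.

Variables (U V : 'M[{poly K}]_n) (d : 'rV[{poly K}]_n).
Hypotheses (unitU : U \in unitmx) (unitV : V \in unitmx) (d_chain : dvd_chain d).
Let M := U *m diag_mx d *m V.

(** Together with the converse below: the product of the first m diagonal entries
    is the gcd of the minors of order m. *)
Lemma chain_prod_dvd_minor m (h k : 'I_m -> 'I_n) :
  chain_prod d m %| \det (mxsub h k M).
Proof.
have -> : mxsub h k M = (rowsub h U *m diag_mx d) *m colsub k V.
  by rewrite mxsub_mul -mul_rowsub_mx.
rewrite det_mulmx_rows; apply: dvdp_sum => f.
have [f_inj|f_ninj] := pselect (injective f); last first.
  by rewrite det_rowsub_noninj // mulr0 dvdp0.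
apply: dvdp_mulr; have -> : \prod_i (rowsub h U *m diag_mx d) i (f i)
    = \prod_i U (h i) (f i) * \prod_i d 0 (f i).
  by rewrite -big_split; apply: eq_bigr => i _; rewrite mul_mx_diag !mxE.
exact/dvdp_mull/chain_prod_dvd.
Qed.

Lemma dvd_minors_chain_prod m q : (m <= n)%N ->
  (forall h k : 'I_m -> 'I_n, {homo h : i j / (i < j)%N} ->
     {homo k : i j / (i < j)%N} -> q %| \det (mxsub h k M)) ->
  q %| chain_prod d m.
Proof.
move=> le_mn dvd_minor.
have dvd_all (f g : 'I_m -> 'I_n) : injective f -> injective g ->
    q %| \det (mxsub f g M).
  move=> /increasing_sort [h h_inc [s fE]] /increasing_sort [k k_inc [t gE]].
  by rewrite (det_mxsub_perm _ fE gE) dvdp_mull // dvd_minor.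
pose w := widen_ord le_mn.
have -> : chain_prod d m = \det (mxsub w w (diag_mx d)).
  have -> : mxsub w w (diag_mx d) = diag_mx (\row_i d 0 (w i)).
    by apply/matrixP => i j; rewrite !mxE.
  rewrite det_diag /chain_prod (big_ord_narrow le_mn).
  by apply: eq_bigr => i _; rewrite mxE.
have -> : mxsub w w (diag_mx d) = rowsub w (invmx U) *m (M *m colsub w (invmx V)).
  rewrite mulmx_colsub -mxsub_mul; congr (mxsub w w _).
  by rewrite /M mulmxK // mulKmx.
rewrite det_mulmx_rows; apply: dvdp_sum => f.
have [f_inj|f_ninj] := pselect (injective f); last first.
  by rewrite det_rowsub_noninj // mulr0 dvdp0.
apply: dvdp_mull.
have -> : rowsub f (M *m colsub w (invmx V)) = ((colsub w (invmx V))^T *m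
  (rowsub f M)^T)^T.
  by rewrite trmx_mul !trmxK mul_rowsub_mx.
rewrite det_tr det_mulmx_rows; apply: dvdp_sum => g.
have [g_inj|g_ninj] := pselect (injective g); last first.
  by rewrite det_rowsub_noninj // mulr0 dvdp0.
apply: dvdp_mull.
have -> : rowsub g (rowsub f M)^T = (mxsub f g M)^T by apply/matrixP => i j;
  rewrite !mxE.
by rewrite det_tr dvd_all.
Qed.

End DeterminantalDivisors.

(** * Invariant factors of the homogeneous pencil *)

Section RankDiag.
Local Open Scope ring_scope.

Lemma mxrank_equiv (F : fieldType) n (U D V : 'M[F]_n) :
  U \in unitmx -> V \in unitmx -> \rank (U *m D *m V) = \rank D.
Proof.
move=> unitU unitV; rewrite mxrankMfree ?row_free_unit //.
by have fullU : row_full U; rewrite ?row_full_unit // (eqmxMfull _ fullU).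
Qed.

Lemma mxrank_diag (F : fieldType) n r (w : 'rV[F]_n) : (r <= n)%N ->
  (forall i : 'I_n, (w 0 i != 0) = (i < r)%N) -> \rank (diag_mx w) = r.
Proof.
move=> le_rn w_n0; pose w' := \row_i (if (i < r)%N then w 0 i else 1).
have -> : diag_mx w = diag_mx w' *m pid_mx r.
  apply/matrixP => i j; rewrite mul_diag_mx !mxE.
  have [->|neq_ij] := eqVneq i j;
    last by rewrite (inj_eq val_inj) (negPf neq_ij) mulr0.
  rewrite eqxx mulr1n /=.
  case: ifP => [_|lt_j]; first by rewrite mulr1.
  by rewrite mulr0; apply/eqP; rewrite -[_ == _]negbK w_n0 lt_j.
rewrite -[RHS](@rank_pid_mx F n n r) //.
have full_w' : row_full (diag_mx w'); last by rewrite (eqmxMfull _ full_w').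
rewrite row_full_unit unitmxE det_diag unitfE; apply/prodf_neq0 => i _;
  rewrite mxE; case: ifP => [lt_i|_]; last exact: oner_neq0.
by rewrite w_n0.
Qed.

Lemma mxrank_diag_le (F : fieldType) n r (w : 'rV[F]_n) : (r <= n)%N ->
  (forall i : 'I_n, (r <= i)%N -> w 0 i = 0) -> (\rank (diag_mx w) <= r)%N.
Proof.
move=> le_rn w0; have -> : diag_mx w = diag_mx w *m pid_mx r.
  apply/matrixP => i j; rewrite mul_diag_mx !mxE.
  have [->|neq_ij] := eqVneq i j;
    last by rewrite (inj_eq val_inj) (negPf neq_ij) mulr0.
  rewrite eqxx mulr1n /=.
  by case: ltnP => [_|/w0 ->]; rewrite ?mulr1 ?mul0r.
by apply: leq_trans (mxrankM_maxr _ _) _; rewrite rank_pid_mx.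
Qed.

Lemma map_unitmx_rmorph (R S : comUnitRingType) (f : {rmorphism R -> S}) n (U :
  'M[R]_n) :
  U \in unitmx -> map_mx f U \in unitmx.
Proof. by rewrite !unitmxE det_map_mx; apply: rmorph_unit. Qed.

End RankDiag.

Section InvariantFactors.
Local Open Scope ring_scope.
Variables (K : fieldType) (n : nat).

Lemma dvd_chain_rank (d : 'rV[{poly K}]_n) : dvd_chain d ->
  exists2 r, (r <= n)%N & forall i : 'I_n, (d 0 i != 0) = (i < r)%N.
Proof.
move=> chain; pose P r := [forall i : 'I_n, (r <= i)%N ==> (d 0 i == 0)].
have exP : exists r, P r.
  by exists n; apply/forallP => i; rewrite leqNgt ltn_ord.
have [r /forallP Pr rmin] := ex_minnP exP.
exists r.
  by apply: rmin; apply/forallP => i; rewrite leqNgt ltn_ord.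
move=> i; have [lt_i|le_i] := ltnP i r; last first.
  by apply/negbTE; rewrite negbK; have := Pr i; rewrite le_i.
have : ~~ P i by apply: contraL lt_i => /rmin; rewrite -leqNgt.
rewrite negb_forall => /existsP [j]; rewrite negb_imply => /andP [le_ij dj].
by apply: contraNneq dj => di; have := chain i j le_ij; rewrite di dvd0p.
Qed.

Variables (A B : 'M[K]_n) (c : K) (U V : 'M[{poly K}]_n) (d : 'rV[{poly K}]_n)
  (r : nat).
Hypotheses (unitU : U \in unitmx) (unitV : V \in unitmx) (d_chain : dvd_chain d).
Hypothesis smith : lpencil A (B + c *: A) = U *m diag_mx d *m V.
Hypotheses (le_rn : (r <= n)%N) (rank_d : forall i : 'I_n, (d 0 i != 0) = (i <
  r)%N).

(** Over the fraction field the pencil is ell times the value of the dehomogenized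
    pencil at lambda / ell, so the Smith form gives its rank as well. *)
Lemma rank_frac_pencil : rank_frac (pencil A B) = r.
Proof.
rewrite /rank_frac (pencil_ell c) tofrac_pencil ?ell_neq0 //.
rewrite mxrank_scale_nz ?tofrac_eq0 ?ell_neq0 // smith !map_mxM map_diag_mx.
rewrite mxrank_equiv ?map_unitmx_rmorph //; apply: mxrank_diag => // i.
rewrite mxE -rank_d; congr (~~ _); apply/eqP/eqP => [s0|->];
  last by rewrite rmorph0.
have size_d := leqSpred (size (d 0 i)).
rewrite -(dehomogK c size_d).
have /eqP := tofrac_homog (cst_morph K) (lam K) (ell_neq0 c) size_d.
by rewrite s0 mulr0 tofrac_eq0 => /eqP ->; rewrite rmorph0.
Qed.

Lemma chain_prod_neq0 m : (m <= r)%N -> chain_prod d m != 0.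
Proof.
move=> le_mr; apply/prodf_neq0 => i lt_i.
by rewrite rank_d (leq_trans lt_i).
Qed.

Lemma chain_prodS (i : 'I_n) : chain_prod d i.+1 = d 0 i * chain_prod d i.
Proof.
rewrite /chain_prod (bigD1 i) //=; congr (_ * _); apply: eq_bigl => j.
by rewrite ltnS [RHS]ltn_neqAle andbC.
Qed.

(** Dehomogenization sends divisors to divisors.  Conversely the minors of order m
    are homogeneous of degree m, so a common divisor of their dehomogenizations
    homogenizes to a common divisor. *)
Lemma dehomog_gcd m G : (m <= r)%N -> is_gcd (is_minor (pencil A B) m) G ->
  dehomog c G %= chain_prod d m.
Proof.
move=> le_mr [G_dvd G_max]; have le_mn := leq_trans le_mr le_rn.
apply/andP; split.
  apply: (dvd_minors_chain_prod unitU unitV) => // h k h_inc k_inc.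
  rewrite -smith -dehomog_minor.
  have [|a ->] := G_dvd (\det (mxsub h k (pencil A B))); first by exists h, k.
  by rewrite rmorphM dvdp_mull.
set p := chain_prod d m; have p_n0 : p != 0 by exact: chain_prod_neq0.
set b := (size p).-1; have size_p : (size p <= b.+1)%N by exact: leqSpred.
rewrite -(dehomogK c size_p).
suff /G_max [a ->] : forall a, is_minor (pencil A B) m a ->
    divides (homog (cst_morph K) (lam K) (ell c) b p) a.
  by rewrite rmorphM dvdp_mull.
move=> _ [h [k [_ _ ->]]]; rewrite (minor_homog c).
have := chain_prod_dvd_minor U V d_chain h k; rewrite -smith -/p => /dvdpP [q qE].
rewrite qE; have [->|q_n0] := eqVneq q 0.
  exists 0; rewrite mul0r /homog big1 ?mul0r // => i _.
  by rewrite coef0 rmorph0 !mul0r.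
have size_qp : (size (q * p)%R <= m.+1)%N.
  rewrite -qE; have -> : mxsub h k (lpencil A (B + c *: A))
      = lpencil (mxsub h k A) (mxsub h k (B + c *: A)).
    by apply/matrixP => i j; rewrite !mxE.
  exact: size_det_lpencil.
move: size_qp; rewrite size_mul // => size_qp.
have p_gt0 : (0 < size p)%N by rewrite size_poly_gt0.
have q_gt0 : (0 < size q)%N by rewrite size_poly_gt0.
have -> : m = (m - b + b)%N.
  by rewrite subnK // /b; move: size_qp p_gt0 q_gt0; move: (size p) (size q); lia.
rewrite homogM ?ell_neq0 //;
  first by exists (homog (cst_morph K) (lam K) (ell c) (m - b) q).
by rewrite /b; move: size_qp p_gt0 q_gt0; move: (size p) (size q); lia.
Qed.

Lemma dehomog_invariant_factor i_ (i : 'I_n) : (i < r)%N ->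
  invariant_factors (pencil A B) i_ -> dehomog c (i_ i.+1) %= d 0 i.
Proof.
move=> lt_ir [G [G_gcd i1E iSE]]; rewrite rank_frac_pencil in G_gcd iSE.
have GS : dehomog c (G i.+1) %= d 0 i * chain_prod d i.
  by rewrite -chain_prodS; apply: dehomog_gcd => //; apply: G_gcd; rewrite lt_ir.
have [i0|i_gt0] := posnP i.
  by move: GS; rewrite i0 -i1E /chain_prod [X in _ * X]big1 ?mulr1.
have Gi : dehomog c (G i) %= chain_prod d i.
  by apply: dehomog_gcd (ltnW lt_ir) _; apply: G_gcd; rewrite i_gt0 ltnW.
rewrite -(eqp_mul2r _ _ (chain_prod_neq0 (ltnW lt_ir))).
apply: eqp_trans GS; rewrite -iSE ?ltnS ?i_gt0 // rmorphM /=.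
by apply: eqp_mull; rewrite eqp_sym.
Qed.

End InvariantFactors.

(** * Degrees and real roots of the elementary divisors *)

Section RootExcess.
Local Open Scope ring_scope.
Variable R : rcfType.
Implicit Types (p q : {poly R}).

(** For p nonzero, the dimension of the kernel of the map from R[t]/(p) to the
    product of the evaluations at the real roots of p. *)
Definition root_excess p := ((size p).-1 - size (rootsR p))%N.

Lemma mem_rootsR p x : p != 0 -> (x \in rootsR p) = root p x.
Proof. by move=> p_n0; rewrite -roots_on_rootsR. Qed.

Lemma uniq_rootsR p : uniq (rootsR p).
Proof. exact: uniq_roots. Qed.

Lemma size_rootsR p s : p != 0 -> uniq s -> (forall x, (x \in s) = root p x) ->
  size (rootsR p) = size s.
Proof.
move=> p_n0 s_uniq sE; apply/perm_size/uniq_perm => // [|x];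
  first exact: uniq_rootsR.
by rewrite mem_rootsR.
Qed.

Lemma size_rootsR_le p : p != 0 -> (size (rootsR p) <= (size p).-1)%N.
Proof.
move=> p_n0; have := max_poly_roots p_n0 _ (uniq_rootsR p) => lt.
rewrite -ltnS prednK ?size_poly_gt0 //; apply: lt.
by apply/allP => x; rewrite mem_rootsR.
Qed.

Lemma root_excess_eqp p q : p %= q -> root_excess p = root_excess q.
Proof.
move=> pq; rewrite /root_excess (eqp_size pq); congr (_ - _)%N.
have [p0|p_n0] := eqVneq p 0; first by move: pq; rewrite p0 eqp_sym eqp0 => /eqP ->.
apply: (size_rootsR p_n0 (uniq_rootsR q)) => x.
rewrite mem_rootsR ?(eqp_root pq) //.
by apply: contraNneq p_n0 => q0; move: pq; rewrite q0 eqp0.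
Qed.

Lemma root_excessM p q : p != 0 -> q != 0 ->
  (forall x, root p x -> root q x -> False) ->
  root_excess (p * q) = (root_excess p + root_excess q)%N.
Proof.
move=> p_n0 q_n0 disj.
have pq_n0 : p * q != 0 by rewrite mulf_neq0.
have -> : root_excess (p * q) = ((size (p * q)%R).-1 - size (rootsR p ++ rootsR
  q))%N.
  congr (_ - _)%N; apply: size_rootsR => // [|x]; last first.
    by rewrite mem_cat !mem_rootsR // rootM.
  rewrite cat_uniq !uniq_rootsR andbT /=; apply/hasPn => x.
  rewrite !mem_rootsR // => qx; apply/negP => px; exact: disj px qx.
rewrite size_cat size_mul // /root_excess.
have := size_rootsR_le p_n0; have := size_rootsR_le q_n0.
move: p_n0 q_n0; rewrite -!size_poly_gt0.
move: (size p) (size q) (size (rootsR p)) (size (rootsR q)).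
lia.
Qed.

Lemma root_excess_prod (T : eqType) (x0 : T) (s : seq T) (F : T -> {poly R}) :
  (forall t, t \in s -> F t != 0) ->
  (forall i j x, (i < j < size s)%N ->
     root (F (nth x0 s i)) x -> root (F (nth x0 s j)) x -> False) ->
  root_excess (\prod_(t <- s) F t) = (\sum_(t <- s) root_excess (F t))%N.
Proof.
elim: s => [|t s IHs] F_n0 disj.
  by rewrite !big_nil /root_excess size_poly1.
rewrite !big_cons root_excessM; last 3 first.
- by apply: F_n0; rewrite mem_head.
- by rewrite prodf_seq_neq0; apply/allP => t' t's;
  rewrite F_n0 ?implybT // in_cons t's orbT.
- move=> x Ftx; rewrite /root horner_prod prodf_seq_eq0.
  move=> /hasP [t' t's /andP [_ Ft'x]].
  apply: (disj 0%N (index t' s).+1 x) => //=; first by rewrite ltnS index_mem.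
  by rewrite nth_index.
congr (_ + _)%N; apply: IHs => [t' t's|i j x lt_ij].
  by apply: F_n0; rewrite in_cons t's orbT.
exact: (disj i.+1 j.+1).
Qed.

Lemma root_excess_linear (a b : R) e : a != 0 -> (0 < e)%N ->
  root_excess ((a *: 'X + b%:P) ^+ e) = (e - 1)%N.
Proof.
move=> a_n0 e_gt0; have size_L : size (a *: 'X + b%:P) = 2%N.
  by rewrite -mul_polyC size_MXaddC polyC_eq0 (negPf a_n0) size_polyC a_n0.
have L_n0 : a *: 'X + b%:P != 0 by rewrite -size_poly_gt0 size_L.
rewrite /root_excess size_exp size_L mul1n.
rewrite (@size_rootsR _ [:: - b / a]) ?expf_neq0 //= => x.
rewrite inE /root horner_exp expf_eq0 e_gt0 /= !hornerE.
apply/eqP/eqP => [->|/eqP]; first by rewrite mulrC divfK // addNr.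
by rewrite addr_eq0 => /eqP <-; rewrite mulrAC divff ?mul1r.
Qed.

Lemma root_excess_noroot p m : p != 0 -> (forall x, ~~ root p x) ->
  root_excess (p ^+ m) = ((size p).-1 * m)%N.
Proof.
move=> p_n0 noroot; rewrite /root_excess size_exp.
rewrite (@size_rootsR _ [::]) ?expf_neq0 ?subn0 // => x.
case: m => [|m]; first by rewrite expr0 /root hornerC oner_eq0.
by rewrite /root horner_exp expf_eq0 /= -/(root p x) (negPf (noroot x)).
Qed.

End RootExcess.

Section Primes.
Local Open Scope ring_scope.
Variable S : idomainType.
Implicit Types (a b p q : S).

Lemma divides_trans a b p : divides a b -> divides b p -> divides a p.
Proof. by move=> [x ->] [y ->]; exists (y * x); rewrite mulrA. Qed.

Lemma divides_exp p n : (0 < n)%N -> divides p (p ^+ n).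
Proof. by case: n => // n _; exists (p ^+ n); rewrite exprSr. Qed.

Lemma prime_divides_exp p a n : prime_elt p -> divides p (a ^+ n) -> divides p a.
Proof.
move=> [_ p_nu p_prime]; elim: n => [[b /esym bp1]|n IHn].
  by case/negP: p_nu; apply/unitrPr; exists b; rewrite mulrC.
by rewrite exprS => /p_prime [].
Qed.

Lemma divides_associates a b : a != 0 -> divides a b -> divides b a ->
  associates a b.
Proof.
move=> a_n0 [x bE] [y aE]; exists y; rewrite // ?mulrC //.
apply/unitrPr; exists x; apply: (mulIf a_n0).
by rewrite mul1r -mulrA -bE -aE.
Qed.

(** The primes of a factorization are only known up to a unit, and a is not known
    to be prime: p and q are compared through a. *)
Lemma prime_powers_associates p q a m n k l :
  prime_elt p -> prime_elt q -> (0 < m)%N -> (0 < n)%N -> (0 < k)%N -> (0 < l)%N ->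
  p ^+ m = a ^+ k -> q ^+ n = a ^+ l -> associates p q.
Proof.
move=> p_prime q_prime m_gt0 n_gt0 k_gt0 l_gt0 pE qE.
have [p_n0 _ _] := p_prime.
have p_a : divides p a by apply: (prime_divides_exp (n := k)) => //;
  rewrite -pE; apply: divides_exp.
have q_a : divides q a by apply: (prime_divides_exp (n := l)) => //;
  rewrite -qE; apply: divides_exp.
apply: divides_associates => //.
  apply: (prime_divides_exp (n := n)) => //; rewrite qE.
  exact: divides_trans p_a (divides_exp _ _).
apply: (prime_divides_exp (n := m)) => //; rewrite pE.
exact: divides_trans q_a (divides_exp _ _).
Qed.

End Primes.

Section ElementaryDivisors.
Local Open Scope ring_scope.
Variables (R : realType) (c : R).
Hypothesis c_n0 : c != 0.
Implicit Types (es : seq nat) (fs : seq (R * nat)) (ms : seq (R[i] * nat)).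

Local Notation phi := (dehomog c).
Local Notation linear_form a := (lam R - mu R * cst a).

Lemma dehomog_linear a : phi (linear_form a) = (1 - c * a) *: 'X + (- a)%:P.
Proof.
rewrite rmorphB rmorphM /= dehomog_lam dehomog_mu dehomogC -!mul_polyC !polyCB
  polyCN polyCM.
ring.
Qed.

Lemma dehomog_muE : phi (mu R) = c *: 'X + 1%:P.
Proof. by rewrite dehomog_mu addrC. Qed.

(** A sum of two squares that vanish together only if both coordinates of the
    point are zero. *)
Lemma dehomog_xi b : phi (xi b) =
  ('X - (complex.Re b)%:P * (1 + c *: 'X)) ^+ 2
  + ((complex.Im b)%:P * (1 + c *: 'X)) ^+ 2.
Proof.
rewrite /xi; case: b => x y /=.
rewrite rmorphD rmorphB (rmorphM _ (cst _)) (rmorphM _ (cst _ * _)) (rmorphM _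
  (cst _)).
rewrite !rmorphXn /= dehomog_lam dehomog_mu !dehomogC -!mul_polyC.
ring.
Qed.

(** L is one of the normalized real linear forms, and it vanishes at
    (lambda, mu) = (x, 1 + c x). *)
Definition vanishes_at (L : {poly {poly R}}) (x : R) :=
  (L = mu R /\ 1 + c * x = 0) \/
  exists a, L = linear_form a /\ x = (1 + c * x) * a.

(** A point of the projective line is the zero of a single normalized form. *)
Lemma vanishes_at_uniq L L' x : vanishes_at L x -> vanishes_at L' x -> L = L'.
Proof.
have absurd a : 1 + c * x = 0 -> x = (1 + c * x) * a -> False.
  move=> cx0 xE; have x0 : x = 0 by rewrite xE cx0 mul0r.
  by move/eqP: cx0; rewrite x0 mulr0 addr0 oner_eq0.
move=> [[-> cx0]|[a [-> xE]]] [[-> cx0']|[a' [-> xE']]] //.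
- by case: (absurd a').
- by case: (absurd a).
have [cx0|cx_n0] := eqVneq (1 + c * x) 0; first by case: (absurd a).
by congr (_ - _ * cst _); apply: (mulfI cx_n0); rewrite -xE.
Qed.

Lemma size_dehomog_xi b : complex.Im b != 0 -> size (phi (xi b)) = 3%N.
Proof.
rewrite dehomog_xi; case: b => x y /= y_n0.
pose a2 := (1 - x * c) ^+ 2 + (y * c) ^+ 2.
have a2_n0 : a2 != 0.
  by rewrite gt_eqF // ltr_wpDl ?sqr_ge0 // exprn_even_gt0 //= mulf_neq0.
have -> : ('X - x%:P * (1 + c *: 'X)) ^+ 2 + (y%:P * (1 + c *: 'X)) ^+ 2
    = (a2%:P * 'X + (2 * (y ^+ 2 * c - x * (1 - x * c)))%:P) * 'X + (x ^+ 2 + y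
      ^+ 2)%:P.
  rewrite /a2 -mul_polyC !(polyCD, polyCM, polyCB, polyCN, polyC_exp, polyC_natr) .
  ring.
by rewrite !size_MXaddC !polyC_eq0 (negPf a2_n0) size_polyC a2_n0
  -size_poly_eq0 size_MXaddC polyC_eq0 (negPf a2_n0) size_polyC a2_n0.
Qed.

Lemma dehomog_xi_noroot b x : complex.Im b != 0 -> ~~ root (phi (xi b)) x.
Proof.
move=> b_n0; rewrite dehomog_xi /root !hornerE paddr_eq0 ?sqr_ge0 //.
rewrite !expf_eq0 /= mulf_eq0 (negPf b_n0) /=.
apply/negP => /andP [] /[swap] /eqP cx0; rewrite cx0 mulr0 subr0 => /eqP x0.
by move/eqP: cx0; rewrite x0 mulr0 addr0 oner_eq0.
Qed.

Definition half_weight es fs ms :=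
  (\sum_(e <- es) (e - 1) + \sum_(q <- fs) (q.2 - 1) + \sum_(q <- ms) 2 * q.2)%N.

Section List.
Variables (es : seq nat) (fs : seq (R * nat)) (ms : seq (R[i] * nat)).
Hypotheses (es_gt0 : forall e, e \in es -> (1 <= e)%N)
  (fs_gt0 : forall q, q \in fs -> (1 <= q.2)%N)
  (ms_gt0 : forall q, q \in ms -> complex.Im q.1 != 0 /\ (1 <= q.2)%N)
  (c_fs : forall q, q \in fs -> 1 - c * q.1 != 0).

Lemma half_divisors_excess :
  (\sum_(h <- half_divisors es fs ms) root_excess (phi h))%N = half_weight es fs ms.
Proof.
rewrite /half_divisors !big_cat /= !big_map addnA /half_weight; congr (_ + _ + _)%N.
- apply: eq_big_seq => e /es_gt0 e_gt0.
  by rewrite rmorphXn /= dehomog_muE root_excess_linear.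
- apply: eq_big_seq => q q_fs.
  by rewrite rmorphXn /= dehomog_linear root_excess_linear ?fs_gt0 ?c_fs.
apply: eq_big_seq => q /ms_gt0 [q_n0 _].
rewrite rmorphXn /= root_excess_noroot ?size_dehomog_xi // => [|x].
  by rewrite -size_poly_gt0 size_dehomog_xi.
exact: dehomog_xi_noroot.
Qed.

Lemma half_divisors_neq0 h : h \in half_divisors es fs ms -> phi h != 0.
Proof.
rewrite !mem_cat => /or3P [] /mapP [q q_in ->]; rewrite rmorphXn /= expf_neq0 //.
- rewrite dehomog_muE; apply/eqP => /(congr1 (fun p : {poly R} => p.[0])).
  by rewrite !hornerE => /eqP; rewrite ?mulr0 ?add0r oner_eq0.
- rewrite dehomog_linear -size_poly_gt0 -mul_polyC size_MXaddC polyC_eq0.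
  by rewrite (negPf (c_fs q_in)).
by rewrite -size_poly_gt0 size_dehomog_xi //; case: (ms_gt0 q_in).
Qed.

Lemma half_divisors_root h x : h \in half_divisors es fs ms -> root (phi h) x ->
  exists L e, [/\ (0 < e)%N, h = L ^+ e & vanishes_at L x].
Proof.
rewrite !mem_cat => /or3P [] /mapP [q q_in ->].
rewrite rmorphXn /= /root horner_exp expf_eq0 es_gt0 //= dehomog_muE !hornerE
  => /eqP qx.
  by exists (mu R), q; rewrite es_gt0 //; split=> //; left; rewrite addrC.
- rewrite rmorphXn /= /root horner_exp expf_eq0 fs_gt0 //= dehomog_linear
  !hornerE => /eqP qx.
  exists (linear_form q.1), q.2; rewrite fs_gt0 //; split=> //; right;
    exists q.1; split=> //.
  by apply/eqP; rewrite -subr_eq0 -[X in _ == X]qx; apply/eqP; ring.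
have [q_n0 _] := ms_gt0 q_in.
by rewrite rmorphXn /= /root horner_exp expf_eq0 -/(root _ _) (negPf
  (dehomog_xi_noroot x q_n0)) andbF.
Qed.

(** Two listed prime powers with a common real root would be powers of the same
    linear form, hence have associate bases. *)
Lemma factorization_excess a s :
  factorization a s ->
  (forall q, q \in s -> q.1 ^+ q.2 \in half_divisors es fs ms) ->
  root_excess (phi a) = (\sum_(q <- s) root_excess (phi (q.1 ^+ q.2)%R))%N.
Proof.
move=> [s_prime s_assoc [u u_unit aE]] s_half.
have -> : root_excess (phi a) = root_excess (\prod_(q <- s) phi (q.1 ^+ q.2)).
  apply: root_excess_eqp; rewrite -rmorph_prod aE rmorphM /=.
  rewrite /eqp dvdp_mull // andbT; apply/dvdpP; exists (phi u^-1).
  by rewrite mulrA -rmorphM mulVr // rmorph1 mul1r.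
apply: (root_excess_prod (x0 := (0, 0%N))) => [q q_s|i j x /andP [lt_ij lt_j]].
  exact/half_divisors_neq0/s_half.
have lt_i := ltn_trans lt_ij lt_j.
set p := nth _ s i; set q := nth _ s j => px qx.
have p_s : p \in s by apply: mem_nth.
have q_s : q \in s by apply: mem_nth.
have [L [k [k_gt0 pE Lx]]] := half_divisors_root (s_half p p_s) px.
have [L' [l [l_gt0 qE L'x]]] := half_divisors_root (s_half q q_s) qx.
rewrite (vanishes_at_uniq L'x Lx) in qE.
have [p_prime p_gt0] := s_prime p p_s; have [q_prime q_gt0] := s_prime q q_s.
apply: (s_assoc i j); first by rewrite lt_ij.
exact: prime_powers_associates p_prime q_prime p_gt0 q_gt0 k_gt0 l_gt0 pE qE.
Qed.

End List.

Lemma sum_invariant_excess n (A B : 'M[R]_n) es fs ms (d : 'rV[{poly R}]_n) r :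
  (r <= n)%N -> rank_frac (pencil A B) = r ->
  (forall i_ (i : 'I_n), (i < r)%N -> invariant_factors (pencil A B) i_ ->
     phi (i_ i.+1) %= d 0 i) ->
  elementary_divisor_pairs A B es fs ms ->
  (forall q, q \in fs -> 1 - c * q.1 != 0) ->
  (\sum_(i < n | (i < r)%N) root_excess (d ord0 i) = 2 * half_weight es fs ms)%N.
Proof.
move=> le_rn rankr phi_i [es_gt0 fs_gt0 ms_gt0 [i_ [fac [inv fac_i perm_E]]]] c_fs.
rewrite rankr in fac_i perm_E.
have fac_half m q : (1 <= m <= r)%N -> q \in fac m -> q.1 ^+ q.2 \in
  half_divisors es fs ms.
  move=> m_r q_fac; suff: q.1 ^+ q.2 \in half_divisors es fs ms ++
    half_divisors es fs ms.
    by rewrite mem_cat orbb.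
  rewrite (perm_mem perm_E); apply/flattenP; exists [seq q.1 ^+ q.2 | q <- fac m].
    by apply/mapP; exists m; rewrite // mem_iota add1n ltnS.
  by apply/mapP; exists q.
rewrite mul2n -addnn -half_divisors_excess // -big_cat /= (perm_big _ perm_E) /=.
rewrite big_flatten big_map /= (big_ord_narrow le_rn) /=.
have -> : iota 1 r = index_iota 1 r.+1 by rewrite /index_iota subn1.
rewrite big_add1 /= big_mkord; apply: eq_bigr => i _; rewrite big_map.
have i_r : (1 <= i.+1 <= r)%N by rewrite ltn_ord.
rewrite -(factorization_excess es_gt0 fs_gt0 ms_gt0 c_fs (fac_i _ i_r)) => [|q].
  by apply: root_excess_eqp; rewrite eqp_sym; apply: (phi_i _ (widen_ord le_rn i)).
exact: fac_half.
Qed.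

End ElementaryDivisors.

(** * Rows lying pointwise in the row space of the pencil *)

Section Generic.
Local Open Scope ring_scope.

(** A certificate for the rank whose determinant stays polynomial when C varies. *)
Lemma rank_witness (F : fieldType) m n (C : 'M[F]_(m, n)) :
  exists L : 'M_(\rank C, m), exists N : 'M_(n, \rank C), L *m C *m N = 1%:M.
Proof.
exists (pid_mx (\rank C) *m invmx (col_ebase C)).
exists (invmx (row_ebase C) *m pid_mx (\rank C)).
suff: pid_mx (\rank C) *m invmx (col_ebase C)
     *m (col_ebase C *m pid_mx (\rank C) *m row_ebase C)
     *m (invmx (row_ebase C) *m pid_mx (\rank C)) = 1%:M :> 'M_(\rank C).
  by rewrite mulmx_ebase.
rewrite !mulmxA mulmxKV ?col_ebase_unit // mulmxK ?row_ebase_unit //.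
rewrite !mul_pid_mx minnn (minn_idPr (rank_leq_row C)) minnn.
by rewrite (minn_idPr (rank_leq_col C)) pid_mx_1.
Qed.

Lemma exists_nonroot (R : numDomainType) (p : {poly R}) :
  p != 0 -> exists x, p.[x] != 0.
Proof.
move=> p_n0; apply: contrapT => /forallNP all0.
have := max_poly_roots p_n0 (rs := [seq i%:R | i <- iota 0 (size p)]).
rewrite size_map size_iota ltnn => /(_ _ _) /notF; apply.
  by apply/allP => x _; have /negP := all0 x; rewrite negbK.
by rewrite map_inj_uniq ?iota_uniq //; apply: mulrIn; apply: oner_neq0.
Qed.

Lemma poly_eq0_horner (R : numDomainType) (p : {poly R}) :
  (forall x, p.[x] = 0) -> p = 0.
Proof.
by move=> p0; apply: contrapT => /eqP /exists_nonroot [x]; rewrite p0 eqxx.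
Qed.

Variable K : fieldType.

Definition coef_mx m n k (Q : 'M[{poly K}]_(m, n)) : 'M[K]_(m, n) :=
  map_mx (fun p : {poly K} => p`_k) Q.

Lemma coef_mxMl m n p k (L : 'M[K]_(m, n)) (Q : 'M[{poly K}]_(n, p)) :
  coef_mx k (map_mx polyC L *m Q) = L *m coef_mx k Q.
Proof.
apply/matrixP => i j; rewrite !mxE coef_sum; apply: eq_bigr => l _.
by rewrite !mxE coefCM.
Qed.

Lemma coef_mxMr m n p k (Q : 'M[{poly K}]_(m, n)) (N : 'M[K]_(n, p)) :
  coef_mx k (Q *m map_mx polyC N) = coef_mx k Q *m N.
Proof.
apply/matrixP => i j; rewrite !mxE coef_sum; apply: eq_bigr => l _.
by rewrite !mxE coefMC.
Qed.

Lemma coef_mxD m n k (Q Q' : 'M[{poly K}]_(m, n)) :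
  coef_mx k (Q + Q') = coef_mx k Q + coef_mx k Q'.
Proof. by apply/matrixP => i j; rewrite !mxE coefD. Qed.

Lemma coef_mxN m n k (Q : 'M[{poly K}]_(m, n)) : coef_mx k (- Q) = - coef_mx k Q.
Proof. by apply/matrixP => i j; rewrite !mxE coefN. Qed.

Lemma coef_mxXn m n k l (Q : 'M[{poly K}]_(m, n)) :
  coef_mx (l + k) ('X^k *: Q) = coef_mx l Q.
Proof. by apply/matrixP => i j; rewrite !mxE coefXnM ltnNge leq_addl addnK. Qed.

Lemma coef_lpencil n (A B : 'M[K]_n) k :
  coef_mx k (lpencil A B) = if k == 0%N then A else if k == 1%N then B else 0.
Proof.
apply/matrixP => i j; rewrite !mxE coefD coefC coefXM coefC.
by case: k => [|[|k]] //=; rewrite ?addr0 ?add0r ?mxE.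
Qed.

Lemma size_mx_leP m n d (Q : 'M[{poly K}]_(m, n)) :
  (forall i j, (size (Q i j) <= d)%N) <-> forall k, (d <= k)%N -> coef_mx k Q = 0.
Proof.
split=> [size_Q k le_k|Q0 i j].
  by apply/matrixP => i j; rewrite !mxE nth_default // (leq_trans (size_Q i j)).
by apply/leq_sizeP => k /Q0 /matrixP /(_ i j); rewrite !mxE.
Qed.

Lemma mulC_lpencil n (A B : 'M[K]_n) (w : 'rV[K]_n) :
  map_mx polyC w *m lpencil A B = map_mx polyC (w *m A) + 'X *: map_mx polyC (w
    *m B).
Proof. by rewrite mulmxDr -scalemxAr -!map_mxM. Qed.

Lemma eval_lpencil n (A B : 'M[K]_n) x :
  map_mx (horner_eval x) (lpencil A B) = A + x *: B.
Proof. by apply/matrixP => i j; rewrite !mxE /horner_eval !hornerE. Qed.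

Lemma eval_polyC m n (L : 'M[K]_(m, n)) x : map_mx (horner_eval x) (map_mx
  polyC L) = L.
Proof. by apply/matrixP => i j; rewrite !mxE /horner_eval hornerC. Qed.

End Generic.

Section RankTop.
Local Open Scope ring_scope.

(** A minor of the leading coefficients that does not vanish is the leading
    coefficient of a polynomial minor, which is nonzero at some point. *)
Lemma rank_top_le (R : numFieldType) m n d r (Q : 'M[{poly R}]_(m, n)) :
  (forall i j, (size (Q i j) <= d.+1)%N) ->
  (forall x, (\rank (map_mx (horner_eval x) Q)%R <= r)%N) ->
  (\rank (coef_mx d Q) <= r)%N.
Proof.
move=> size_Q rank_Q; set C := coef_mx d Q; rewrite leqNgt; apply/negP => lt_r.
have [L [N LCN]] := rank_witness C.
pose P := map_mx polyC L *m Q *m map_mx polyC N.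
have coefP k : coef_mx k P = L *m coef_mx k Q *m N by rewrite coef_mxMr coef_mxMl.
have size_P i j : (size (P i j) <= d.+1)%N.
  apply: (proj2 (size_mx_leP d.+1 P)) => k le_k; rewrite coefP.
  by rewrite (proj1 (size_mx_leP d.+1 Q)) // mulmx0 mul0mx.
have [_] := det_top size_P; rewrite -/(coef_mx d P) coefP LCN det1 => top.
have detP_n0 : \det P != 0.
  by apply: contra_eq_neq top => ->; rewrite coef0 eq_sym oner_neq0.
have [x] := exists_nonroot detP_n0; rewrite -[_.[x]]/(horner_eval x _) -det_map_mx.
rewrite -unitfE -unitmxE -row_free_unit => /eqP.
rewrite !map_mxM !eval_polyC => rankP; move: lt_r; apply/negP; rewrite -leqNgt.
rewrite -[X in (X <= _)%N]rankP; apply: leq_trans (rank_Q x).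
by apply: leq_trans (mxrankM_maxl _ _) (mxrankM_maxr _ _).
Qed.

End RankTop.

Section Radical.
Local Open Scope ring_scope.
Variable R : rcfType.
Implicit Types p q : {poly R}.

Definition real_radical p : {poly R} := \prod_(x <- rootsR p) ('X - x%:P).

Lemma real_radical_dvd p q :
  (forall x, x \in rootsR p -> root q x) -> real_radical p %| q.
Proof.
move=> qx; apply: uniq_roots_dvdp; last by rewrite uniq_rootsE uniq_rootsR.
by apply/allP.
Qed.

Lemma real_radical_root p x : p != 0 -> root p x -> root (real_radical p) x.
Proof.
by move=> p_n0 px; rewrite /real_radical root_prod_XsubC mem_rootsR.
Qed.

Lemma real_radical_monic p : real_radical p \is monic.
Proof. exact: monic_prod_XsubC. Qed.

Lemma size_real_cofactor p : p != 0 ->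
  size (p %/ real_radical p) = (root_excess p).+1.
Proof.
move=> p_n0; rewrite size_divp ?monic_neq0 ?real_radical_monic //.
rewrite size_prod_XsubC /root_excess -subSn ?size_rootsR_le //.
by rewrite prednK ?size_poly_gt0.
Qed.

Lemma real_cofactorK p : p != 0 -> p %/ real_radical p * real_radical p = p.
Proof.
move=> p_n0; apply/divpK/real_radical_dvd => x; by rewrite mem_rootsR.
Qed.

End Radical.

Section PointwiseImage.
Local Open Scope ring_scope.
Variables (R : rcfType) (n : nat) (A B : 'M[R]_n).
Let M := lpencil A B.

(** [pointwise_image 2] encodes the almost inner derivations; larger d are needed
    because the Smith form does not control degrees. *)
Definition pointwise_image d (z : 'rV[{poly R}]_n) :=
  (forall i, (size (z ord0 i) <= d)%N) /\
  forall x, (map_mx (horner_eval x) z <= (A + x *: B)%R)%MS.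

Variables (U V : 'M[{poly R}]_n) (d : 'rV[{poly R}]_n) (r : nat).
Hypotheses (unitU : U \in unitmx) (unitV : V \in unitmx) (d_chain : dvd_chain d).
Hypothesis smith : M = U *m diag_mx d *m V.
Hypotheses (le_rn : (r <= n)%N) (rank_d : forall i : 'I_n, (d 0 i != 0) = (i <
  r)%N).
Hypothesis rankB : \rank B = r.

Lemma rank_eval_le x : (\rank (A + x *: B)%R <= r)%N.
Proof.
rewrite -(eval_lpencil A B x) -/M smith !map_mxM mxrank_equiv ?map_unitmx_rmorph //.
rewrite map_diag_mx; apply: mxrank_diag_le => // i le_ri.
have : d 0 i == 0 by rewrite -[_ == 0]negbK rank_d -leqNgt.
by move=> /eqP di0; rewrite mxE di0 rmorph0.
Qed.

Lemma size_rV_leP k (z : 'rV[{poly R}]_n) :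
  (forall i, (size (z ord0 i) <= k)%N) <-> forall l, (k <= l)%N -> coef_mx l z = 0.
Proof.
rewrite -(size_mx_leP k z); split=> [size_z i j|size_z j]; last exact: size_z.
by rewrite ord1.
Qed.

(** Infinity is not special because the rank of B is generic: otherwise the rank
    of the pencil bordered by z would exceed r at infinity, hence at a real
    point, where z depends on the rows of the pencil. *)
Lemma pointwise_image_top k (z : 'rV[{poly R}]_n) :
  pointwise_image k.+2 z -> (coef_mx k.+1 z <= B)%MS.
Proof.
(* the power of the variable gives both blocks the degree k + 1 *)
move=> [size_z zM]; pose Q := col_mx ('X^k *: M) z.
have top_Q : coef_mx k.+1 Q = col_mx B (coef_mx k.+1 z).
  rewrite /coef_mx map_col_mx -/(coef_mx _ _) -[k.+1]add1n coef_mxXn.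
  by rewrite coef_lpencil.
have size_Q i j : (size (Q i j) <= k.+2)%N.
  apply: (proj2 (size_mx_leP k.+2 Q)) => l le_l.
  rewrite /coef_mx map_col_mx -/(coef_mx _ _) -/(coef_mx _ z).
  rewrite (proj1 (size_rV_leP k.+2 z)) // -(subnK (_ : k <= l)%N) ?coef_mxXn;
    last by lia.
  by rewrite coef_lpencil !ifN ?col_mx0 //; lia.
have := rank_top_le (r := r) size_Q; rewrite top_Q => rank_top.
have {}rank_top : (\rank (col_mx B (coef_mx k.+1 z)) <= r)%N.
  apply: rank_top => x; apply: leq_trans (rank_eval_le x); apply: mxrankS.
  rewrite map_col_mx col_mx_sub zM andbT map_mxZ eval_lpencil.
  exact: scalemx_sub.
have sB : (B <= col_mx B (coef_mx k.+1 z))%MS.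
  by have := submx_refl (col_mx B (coef_mx k.+1 z));
    rewrite {1}col_mx_sub => /andP [].
suff: (col_mx B (coef_mx k.+1 z) <= B)%MS by rewrite col_mx_sub => /andP [].
by rewrite -(mxrank_leqif_sup sB) eqn_leq mxrankS //= rankB.
Qed.

Local Notation rB := (\rank B).

(** Multiplied by B, these rows give a basis of the row space of B. *)
Definition row_lift : 'M[R]_(rB, n) := row_base B *m pinvmx B.

Lemma row_liftB : row_lift *m B = row_base B.
Proof. by rewrite /row_lift mulmxKpV // eq_row_base. Qed.

(** Multiples of M whose coefficients of degree k + 2 form a basis of the row
    space of B, and which have no higher ones. *)
Definition top_mx k : 'M[{poly R}]_(rB, n) :=
  'X^(k.+1) *: (map_mx polyC row_lift *m M).

Lemma coef_top_mx k (v : 'rV[R]_rB) :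
  coef_mx k.+2 (map_mx polyC v *m top_mx k) = v *m row_base B.
Proof. by rewrite coef_mxMl -[k.+2]add1n coef_mxXn coef_mxMl coef_lpencil
  row_liftB. Qed.

Lemma size_top_mx k (v : 'rV[R]_rB) i :
  (size ((map_mx polyC v *m top_mx k)%R ord0 i) <= k.+3)%N.
Proof.
apply: (proj2 (size_rV_leP k.+3 _)) => l le_l.
rewrite -(subnK (_ : k.+1 <= l)%N) ?coef_mxMl ?coef_mxXn; last by lia.
by rewrite coef_mxMl coef_lpencil !ifN ?mulmx0 //; lia.
Qed.

Lemma eval_mulM_sub (y : 'rV[{poly R}]_n) x :
  (map_mx (horner_eval x) (y *m M) <= (A + x *: B)%R)%MS.
Proof. by rewrite map_mxM eval_lpencil submxMl. Qed.

Lemma top_mxE k (v : 'rV[R]_rB) :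
  map_mx polyC v *m top_mx k = ('X^(k.+1) *: map_mx polyC (v *m row_lift)) *m M.
Proof. by rewrite /top_mx -scalemxAr mulmxA -map_mxM scalemxAl. Qed.

Lemma pointwise_image_reduce k (z : 'rV[{poly R}]_n) : pointwise_image k.+3 z ->
  exists v : 'rV[R]_rB, pointwise_image k.+2 (z - map_mx polyC v *m top_mx k).
Proof.
move=> zP; have := pointwise_image_top zP;
  rewrite -(eq_row_base B) => /submxP [v vE].
have [size_z zM] := zP; exists v; split=> [|x]; last first.
  by rewrite map_mxB addmx_sub ?zM // eqmx_opp top_mxE eval_mulM_sub.
apply/size_rV_leP => l; rewrite leq_eqVlt => /orP [/eqP <-|lt_l].
  by rewrite coef_mxD coef_mxN coef_top_mx vE subrr.
rewrite coef_mxD coef_mxN (proj1 (size_rV_leP k.+3 z)) // (proj1 (size_rV_leP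
  k.+3 _)) ?subrr // => i.
exact: size_top_mx.
Qed.

Lemma polydim_pointwise_image a k :
  polydim (pointwise_image 2) a -> polydim (pointwise_image k.+2) (a + k * r).
Proof.
move=> dim2; elim: k => [|k IHk]; first by rewrite addn0.
have dim_top : polydim (fun z => exists v, z = map_mx polyC v *m top_mx k) r.
  rewrite -[X in polydim _ X]rankB; exists (top_mx k) => [v|//].
  move=> /(congr1 (coef_mx k.+2)); rewrite coef_top_mx => v0.
  have := row_base_free B => /row_free_inj; apply; rewrite mul0mx v0.
  by apply/matrixP => i j; rewrite !mxE coef0.
rewrite mulSn [(r + _)%N]addnC addnA.
suff disj x y : pointwise_image k.+2 x -> (exists v, y = map_mx polyC v *m
  top_mx k) ->
    x + y = 0 -> x = 0 /\ y = 0.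
  apply: polydim_ext (polydim_add disj IHk dim_top) => z.
  split=> [[x [_ [[size_x xM] [v ->] ->]]]|zP].
    split=> [i|t]; last by rewrite map_mxD addmx_sub ?xM // top_mxE eval_mulM_sub.
    rewrite mxE; apply: leq_trans (size_polyD _ _) _.
    by rewrite geq_max size_top_mx (leq_trans (size_x i)).
  have [v zv] := pointwise_image_reduce zP.
  exists (z - map_mx polyC v *m top_mx k), (map_mx polyC v *m top_mx k).
  by split; rewrite ?subrK //; exists v.
move=> [size_x xM] [v ->] xv0.
suff v0 : v = 0 by move: xv0; rewrite v0 map_mx0 mul0mx addr0.
have := row_base_free B => /row_free_inj; apply; rewrite mul0mx -(coef_top_mx k).
have -> : map_mx polyC v *m top_mx k = - x by apply/eqP;
  rewrite -addr_eq0 addrC xv0.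
move/size_rV_leP: size_x => /(_ k.+2 (leqnn _)) /matrixP x0.
by apply/matrixP => i j; have := x0 i j; rewrite !mxE coefN => ->; rewrite oppr0.
Qed.

Lemma pointwise_image_decomp k (z : 'rV[{poly R}]_n) : pointwise_image k.+2 z ->
  exists (z1 y : 'rV[{poly R}]_n), [/\ pointwise_image 2 z1, forall i, (size (y
    ord0 i) <= k.+1)%N &
    z = z1 + y *m M].
Proof.
elim: k z => [|k IHk] z zP.
  by exists z, 0; split=> // [i|]; rewrite ?mul0mx ?addr0 // mxE size_poly0.
have [v /IHk [z1 [y [z1P size_y zE]]]] := pointwise_image_reduce zP.
exists z1, (y + 'X^(k.+1) *: map_mx polyC (v *m row_lift)); split=> // [i|].
  rewrite mxE; apply: leq_trans (size_polyD _ _) _.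
  rewrite geq_max (leq_trans (size_y i)) //= !mxE mulrC mul_polyC.
  by apply: leq_trans (size_scale_leq _ _) _; rewrite size_polyXn.
by rewrite mulmxDl -top_mxE addrA -zE subrK.
Qed.

Let rad i := real_radical (d 0 i).

(** The coordinates of z with respect to V vanish at the real roots of the
    diagonal entries.  For a zero entry the radical is 1, while the coordinate
    vanishes everywhere. *)
Lemma pointwise_image_smith k (z : 'rV[{poly R}]_n) i :
  pointwise_image k z -> d 0 i %/ rad i * rad i = d 0 i /\
  exists w, (z *m invmx V) 0 i = w * rad i /\ (d 0 i = 0 -> w = 0).
Proof.
move=> [_ zM]; set wi := (z *m invmx V) 0 i.
have w_root x : root (d 0 i) x -> root wi x.
  have /submxP [y yE] := zM x.
  have : map_mx (horner_eval x) z *m map_mx (horner_eval x) (invmx V)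
      = y *m (A + x *: B) *m map_mx (horner_eval x) (invmx V) by rewrite yE.
  rewrite -(eval_lpencil A B) -/M smith -map_mxM -mulmxA -map_mxM mulmxK //.
  move=> /matrixP /(_ 0 i);
    rewrite mxE -/wi map_mxM map_diag_mx mulmxA mul_mx_diag !mxE.

  by move=> wiE /eqP dix; apply/eqP; move: wiE; rewrite /= /horner_eval dix mulr0.
have [di0|di_n0] := eqVneq (d 0 i) 0; last first.
  split; first exact: real_cofactorK.
  have /dvdpP [w wE] : rad i %| wi.
    by apply: real_radical_dvd => x; rewrite mem_rootsR //; apply: w_root.
  by exists w; split=> // di0; rewrite di0 eqxx in di_n0.
rewrite di0 div0p mul0r; split=> //; exists 0; split=> //; rewrite mul0r.
apply: poly_eq0_horner => x; apply/eqP/w_root; by rewrite di0 root0.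
Qed.

Definition mx_size_bound p q (Q : 'M[{poly R}]_(p, q)) :=
  (\sum_i \sum_j size (Q i j))%N.

Lemma size_mulmx_le p q (u : 'rV[{poly R}]_p) (Q : 'M[{poly R}]_(p, q)) k j :
  (forall i, (size (u ord0 i) <= k)%N) ->
  (size ((u *m Q)%R ord0 j) <= k + mx_size_bound Q)%N.
Proof.
move=> size_u; rewrite mxE; apply: leq_trans (size_sum _ _ _) _.
apply/bigmax_leqP => i _; apply: leq_trans (size_polyMleq _ _) _.
apply: leq_trans (leq_pred _) _; apply: leq_add (size_u i) _.
by rewrite /mx_size_bound (bigD1 i) //= (bigD1 j) //= -addnA leq_addr.
Qed.

Let theta i := root_excess (d 0 i).

Let H : 'M[{poly R}]_(n + n, n) := col_mx (diag_mx (\row_i rad i) *m V) M.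

Lemma theta0 i : d 0 i = 0 -> theta i = 0%N.
Proof. by move=> di0; rewrite /theta di0 /root_excess size_poly0. Qed.

(** Divide the coordinates of z, already divisible by the radicals, by the
    cofactors d i / rad i: the remainders give u and the quotients a multiple of
    M.  Only z of degree at most 1 is divided, so a single bound N on the degree
    of y works for all k. *)
Lemma pointwise_image_cover : exists N, forall k, (N <= k)%N -> forall z,
  pointwise_image k.+2 z <-> exists u y : 'rV[{poly R}]_n,
    [/\ forall i, (size (u ord0 i) <= theta i)%N, forall i, (size (y ord0 i) <=
      k.+1)%N
      & z = row_mx u y *m H].
Proof.
pose size_rad := (\sum_i (size (rad i) + theta i))%N.
exists (2 + mx_size_bound (invmx V) + mx_size_bound (invmx U) + (size_rad +
  mx_size_bound V))%N.
move=> k le_k z; split=> [zP|[u [y [size_u size_y ->]]]]; last first.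
  rewrite mul_row_col; split=> [i|x].
    rewrite mxE; apply: leq_trans (size_polyD _ _) _; rewrite geq_max;
      apply/andP; split.
      rewrite mulmxA; apply: leq_trans (size_mulmx_le (k := size_rad) _ _ _) _;
        last by lia.
      move=> j; rewrite mul_mx_diag !mxE; apply: leq_trans (size_polyMleq _ _) _.
      apply: leq_trans (leq_pred _) _;
        apply: leq_trans (leq_add (size_u j) (leqnn _)) _.
      by rewrite /size_rad (bigD1 j) //= [(theta j + _)%N]addnC leq_addr.
    rewrite mxE; apply: leq_trans (size_sum _ _ _) _; apply/bigmax_leqP => j _.
    apply: leq_trans (size_polyMleq _ _) _.
    have size_M : (size (M j i) <= 2)%N.
      apply: (proj2 (size_mx_leP 2 M)) => l le_l; rewrite coef_lpencil !ifN //; lia.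
    have := size_y j; move: size_M; move: (size (y ord0 j)) (size (M j i)); lia.
  rewrite map_mxD addmx_sub ?eval_mulM_sub // mulmxA.
  rewrite -(eval_lpencil A B) -/M smith !map_mxM !map_diag_mx.
  set w := map_mx (horner_eval x) u *m _; set D := diag_mx (map_mx _ d).
  have w0 i : (d 0 i).[x] = 0 -> w 0 i = 0.
    move=> dix; rewrite /w mul_mx_diag !mxE /= /horner_eval.
    have [di0|di_n0] := eqVneq (d 0 i) 0.
      have := size_u i; rewrite theta0 // leqn0 size_poly_eq0 => /eqP ->.
      by rewrite horner0 mul0r.
    have /eqP -> : root (rad i) x by apply: real_radical_root => //; apply/eqP.
    by rewrite mulr0.
  pose w' := \row_i (w 0 i / (d 0 i).[x]).
  have -> : w = w' *m D.
    apply/rowP => i; rewrite /D mul_mx_diag [RHS]mxE [w' _ _]mxE [map_mx _ d _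
      _]mxE /= /horner_eval.
    by have [dix|dix] := eqVneq (d 0 i).[x] 0; [rewrite dix mulr0 w0|rewrite divfK].
  apply/submxP; exists (w' *m map_mx (horner_eval x) (invmx U)).
  by rewrite !mulmxA -[w' *m _ *m map_mx _ U]mulmxA -map_mxM mulVmx // map_mx1
    mulmx1.
have [z1 [y [z1P size_y zE]]] := pointwise_image_decomp zP.
have radE i : d 0 i %/ rad i * rad i = d 0 i by case: (pointwise_image_smith i z1P).
have [w wE] := fin_all_exists (fun i => proj2 (pointwise_image_smith i z1P)).
pose e i := d 0 i %/ rad i.
pose u : 'rV[{poly R}]_n := \row_i (w i %% e i).
pose q : 'rV[{poly R}]_n := \row_i (w i %/ e i).
have z1E : z1 = u *m (diag_mx (\row_i rad i) *m V) + q *m invmx U *m M.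
  rewrite smith !mulmxA mulmxKV // -mulmxDl -[LHS](mulmxKV unitV); congr (_ *m V).
  apply/rowP => i; case: (wE i) => -> _;
    rewrite !mul_mx_diag !mxE addrC -{1}(radE i) -/(e i).
  by rewrite {1}(divp_eq (w i) (e i)) mulrA -mulrDl.
exists u, (q *m invmx U + y); split=> [i|i|]; last 1 first.
- by rewrite mul_row_col mulmxDl addrA -z1E.
- rewrite mxE; have [di0|di_n0] := eqVneq (d 0 i) 0.
    by case: (wE i) => _ ->; rewrite // mod0p size_poly0.
  have := size_real_cofactor di_n0; rewrite -/(rad i) -/(e i) -/(theta i) => size_e.
  by rewrite -ltnS -size_e ltn_modp -size_poly_gt0 size_e.
rewrite mxE; apply: leq_trans (size_polyD _ _) _; rewrite geq_max size_y andbT.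
apply: leq_trans (size_mulmx_le (k := (2 + mx_size_bound (invmx V))%N) _ _ _)
  _; last by lia.
move=> j; rewrite mxE; apply: leq_trans (leq_divp _ _) _.
apply: leq_trans (size_mulmx_le (u := z1) (invmx V) j (proj1 z1P)).
case: (wE j) => -> _; have [->|w_n0] := eqVneq (w j) 0; first by rewrite size_poly0.
have rad_n0 : rad j != 0 by rewrite monic_neq0 ?real_radical_monic.
rewrite size_mul //; move: rad_n0; rewrite -size_poly_gt0.
by move: (size (w j)) (size (rad j)) => a b; lia.
Qed.

(** Each u i is divisible by the cofactor of d i, whose degree is theta i. *)
Lemma pointwise_image_kernel (u y : 'rV[{poly R}]_n) :
  (forall i, (size (u ord0 i) <= theta i)%N) ->
  row_mx u y *m H = 0 -> u = 0.
Proof.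
move=> size_u; rewrite mul_row_col smith !mulmxA -mulmxDl => uy0.
have {}uy0 : u *m diag_mx (\row_i rad i) + y *m U *m diag_mx d = 0.
  by rewrite -[LHS](mulmxK unitV) uy0 mul0mx.
apply/rowP => i; rewrite [RHS]mxE; have [di0|di_n0] := eqVneq (d 0 i) 0.
  by apply/eqP; have := size_u i; rewrite theta0 // leqn0 size_poly_eq0.
have := congr1 (fun v : 'rV[{poly R}]_n => v 0 i) uy0.
rewrite !mul_mx_diag mxE [in X in X + _]mxE [in X in _ + X]mxE [X in _ * X +
  _]mxE [RHS]mxE.
rewrite -{1}(real_cofactorK di_n0) -/(rad i) mulrA -mulrDl => /eqP.
rewrite mulf_eq0 [rad i == 0]negbTE ?monic_neq0 ?real_radical_monic // orbF.
rewrite addr_eq0 => /eqP uiE; apply/eqP; apply: contraT => ui_n0.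
have size_e := size_real_cofactor di_n0; rewrite -/(rad i) -/(theta i) in size_e.
have := gtNdvdp ui_n0 (_ : (size (u ord0 i) < size (d ord0 i %/ rad i)%R)%N).
rewrite size_e ltnS size_u => /(_ isT); rewrite uiE -mulNr => /negbT /negP; case.
exact: dvdp_mull.
Qed.

Theorem pointwise_image_count a : polydim (pointwise_image 2) a ->
  exists N, forall k, (N <= k)%N -> forall s, polydim (row_sol A B k.+1) s ->
    (\sum_i root_excess (d ord0 i) + n * k.+1 = s + (a + k * r))%N.
Proof.
move=> dim2; have [N cover] := pointwise_image_cover; exists N => k le_k s dim_s.
pose th (j : 'I_(n + n)) := match split j with inl i => theta i | inr _ => k.+1 end.
have thl i : th (lshift n i) = theta i by rewrite /th (unsplitK (inl _ i)).
have thr i : th (rshift n i) = k.+1 by rewrite /th (unsplitK (inr _ i)).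
have -> : (\sum_i root_excess (d ord0 i) + n * k.+1 = \sum_j th j)%N.
  rewrite big_split_ord /=; congr (_ + _)%N; first by apply: eq_bigr => i _;
    rewrite thl.
  by under eq_bigr do rewrite thr; rewrite sum_nat_const card_ord.
have th_row (u y : 'rV[{poly R}]_n) :
    (forall j, (size (row_mx u y ord0 j) <= th j)%N) <->
    (forall i, (size (u ord0 i) <= theta i)%N) /\ (forall i, (size (y ord0 i)
      <= k.+1)%N).
  split=> [size_uy|[size_u size_y] j].
    split=> i; first by have := size_uy (lshift n i); rewrite row_mxEl thl.
    by have := size_uy (rshift n i); rewrite row_mxEr thr.
  by case: (split_ordP j) => i ->; rewrite ?row_mxEl ?row_mxEr ?thl ?thr.
have dim_img := polydim_pointwise_image k dim2.
apply: (polydim_rank_nullity (H := H) (polydim_box R th)); last first.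
  apply: polydim_ext dim_img => z; rewrite cover //; split.
    by move=> [u [y [size_u size_y ->]]]; exists (row_mx u y) => //; apply/th_row.
  move=> [v]; rewrite -[v]hsubmxK => /th_row [size_u size_y] ->.
  by exists (lsubmx v), (rsubmx v).
have dim_ker := @polydim_klin R n (n + n) _ s (fun y : 'rV[{poly R}]_n =>
  row_mx 0 y) _ _ dim_s.
apply: polydim_ext (dim_ker _ _) => [v|b u y|y _ /eqP]; last 2 first.
- by rewrite scale_row_mx add_row_mx scaler0 addr0.
- by rewrite row_mx_eq0 => /andP [_ /eqP].
split=> [[y [yM size_y] ->]|[]].
  split; last by rewrite mul_row_col mul0mx add0r.
  by apply/th_row; split=> // i; rewrite mxE size_poly0.
rewrite -[v]hsubmxK => /th_row [size_u size_y] v0.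
have u0 := pointwise_image_kernel size_u v0.
move: v0; rewrite u0 mul_row_col mul0mx add0r => yM.
by exists (rsubmx v).
Qed.

End PointwiseImage.

(** * Derivations in coordinates *)

Section LieCoordinates.
Local Open Scope ring_scope.

Lemma submx_colP (F : fieldType) m n (w : 'rV[F]_n) (C : 'M[F]_(m, n)) :
  (forall z : 'cV_n, C *m z = 0 -> w *m z = 0) -> (w <= C)%MS.
Proof.
move=> wz; rewrite submxE; apply/eqP/rowP => j.
have : w *m col j (cokermx C) = 0.
  by apply: wz; rewrite colE mulmxA mulmx_coker mul0mx.
rewrite colE mulmxA -colE => /matrixP /(_ 0 0); by rewrite !mxE.
Qed.

Variables (K : fieldType) (g : lieAlgType K) (n : nat) (x : n.-tuple g) (y1 y2 : g).
Variables (A B : 'M[K]_n).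
Hypotheses (two_step : two_step_nilpotent g) (AB : associated_matrices x y1 y2 A B).

Lemma lieDl (u v w : g) : lie (u + v) w = lie u w + lie v w.
Proof. exact: (linearD (lie_flip w)). Qed.

Lemma lieC (u v : g) : lie u v = - lie v u.
Proof.
have := liexx (u + v); rewrite lieDl (linearD (lie u)) (linearD (lie v)) /= !liexx.
by rewrite add0r addr0 => /eqP; rewrite addr_eq0 => /eqP.
Qed.

Lemma lie_derived (u v : g) : lie u v \in derived_algebra g.
Proof. by have /lie_prodvP := subvv (derived_algebra g); apply; apply: memvf. Qed.

Lemma lie_central (u w : g) : w \in derived_algebra g -> lie u w = 0.
Proof.
move=> wW; have : (lie_prodv fullv (derived_algebra g) <= 0)%VS by rewrite two_step.
move/lie_prodvP => /(_ u w (memvf u) wW).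
by rewrite memv0 => /eqP.
Qed.

Let bt : (n + 2).-tuple g := [tuple of x ++ [:: y1; y2]].

Let bt_basis : basis_of fullv bt. Proof. by case: AB. Qed.

Definition xcoord (v : g) : 'rV[K]_n := \row_i coord bt (lshift 2 i) v.
Definition ycoord1 (v : g) : K := coord bt (rshift n 0) v.
Definition ycoord2 (v : g) : K := coord bt (rshift n 1) v.

Let nth_btl (i : 'I_n) : bt`_(lshift 2 i) = tnth x i.
Proof. by rewrite /= nth_cat size_tuple ltn_ord -tnth_nth. Qed.

Let nth_bt1 : bt`_(rshift n (0 : 'I_2)) = y1.
Proof. by rewrite /= nth_cat size_tuple ltnNge leq_addr /= addKn. Qed.

Let nth_bt2 : bt`_(rshift n (1 : 'I_2)) = y2.
Proof. by rewrite /= nth_cat size_tuple ltnNge leq_addr /= addKn. Qed.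

Lemma coord_decomp v :
  v = \sum_i xcoord v 0 i *: tnth x i + (ycoord1 v *: y1 + ycoord2 v *: y2).
Proof.
rewrite {1}(coord_basis bt_basis (memvf v)) big_split_ord /= !big_ord_recl
  big_ord0 addr0.
congr (_ + _); first by apply: eq_bigr => i _; rewrite mxE nth_btl.
have -> : lift ord0 ord0 = 1 :> 'I_2 by apply: val_inj.
by rewrite nth_bt1 nth_bt2.
Qed.

Let coord_bt (i j : 'I_(n + 2)) : coord bt i bt`_j = (i == j)%:R.
Proof. by rewrite coord_free ?(basis_free bt_basis) // eq_sym. Qed.

Lemma xcoordx i : xcoord (tnth x i) = delta_mx 0 i.
Proof.
by apply/rowP => j; rewrite !mxE -nth_btl coord_bt (inj_eq (@lshift_inj _ _)).
Qed.

Lemma xcoord_y p q : xcoord (p *: y1 + q *: y2) = 0.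
Proof.
apply/rowP => j; rewrite !mxE linearD !linearZ /= -nth_bt1 -nth_bt2 !coord_bt.
by rewrite !eq_lrshift !mulr0 addr0.
Qed.

Lemma ycoord1_y p q : ycoord1 (p *: y1 + q *: y2) = p.
Proof.
rewrite /ycoord1 linearD !linearZ /= -nth_bt1 -nth_bt2 !coord_bt.
by rewrite eqxx !(inj_eq (@rshift_inj _ _)) /= mulr1 mulr0 addr0.
Qed.

Lemma ycoord2_y p q : ycoord2 (p *: y1 + q *: y2) = q.
Proof.
rewrite /ycoord2 linearD !linearZ /= -nth_bt1 -nth_bt2 !coord_bt.
by rewrite eqxx !(inj_eq (@rshift_inj _ _)) /= mulr1 mulr0 add0r.
Qed.

Lemma derivedP w : w \in derived_algebra g ->
  w = ycoord1 w *: y1 + ycoord2 w *: y2.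
Proof.
case: AB => _ /andP [/eqP <- _] _; rewrite span_cons span_seq1 => /memv_addP.
move=> [_ /vlineP [p ->] [_ /vlineP [q ->] ->]].
by rewrite ycoord1_y ycoord2_y.
Qed.

Lemma y_derived p q : p *: y1 + q *: y2 \in derived_algebra g.
Proof.
case: AB => _ /andP [/eqP <- _] _.
by rewrite memvD ?memvZ // memv_span // !inE eqxx ?orbT.
Qed.

Definition xcomb (a : 'rV[K]_n) : g := \sum_i a 0 i *: tnth x i.

Lemma xcoord_xcomb a : xcoord (xcomb a) = a.
Proof.
apply/rowP => j; rewrite mxE linear_sum (bigD1 j) //= big1 => [|i i_nj].
  by rewrite linearZ /= -nth_btl coord_bt eqxx mulr1 addr0.
rewrite linearZ /= -nth_btl coord_bt (inj_eq (@lshift_inj _ _)) eq_sym.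
by rewrite (negPf i_nj) mulr0.
Qed.

(** The derived algebra is central, so only the coordinates on x matter. *)
Lemma lie_coord u v : lie u v
  = (xcoord u *m A *m (xcoord v)^T) 0 0 *: y1
    + (xcoord u *m B *m (xcoord v)^T) 0 0 *: y2.
Proof.
have lie_x w i : lie (tnth x i) w = \sum_j xcoord w 0 j *: (A i j *: y1 + B i j
  *: y2).
  rewrite {1}(coord_decomp w) linearD /= (lie_central _ (y_derived _ _)) addr0
    linear_sum.
  by apply: eq_bigr => j _; rewrite linearZ /=; case: AB => _ _ ->.
have -> : lie u v = \sum_i xcoord u 0 i *: lie (tnth x i) v.
  rewrite {1}(coord_decomp u) -[lie _ v]/(lie_flip _ _) linearD /= {2}/lie_flip.
  rewrite [lie (_ *: y1 + _) v]lieC (lie_central _ (y_derived _ _)) oppr0 addr0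
    linear_sum.
  by apply: eq_bigr => i _; rewrite linearZ.
under eq_bigr do rewrite lie_x scaler_sumr.
rewrite exchange_big /= !mxE !scaler_suml -big_split; apply: eq_bigr => j _ /=.
rewrite !mxE !mulr_suml !scaler_suml -big_split; apply: eq_bigr => i _ /=.
by rewrite !scalerDr !scalerA; congr (_ *: _ + _ *: _); ring.
Qed.

Lemma associated_skew : A^T = - A /\ B^T = - B.
Proof.
have lieE i j : lie (tnth x i) (tnth x j) = A i j *: y1 + B i j *: y2 by case: AB.
split; apply/matrixP => i j; rewrite !mxE.
  by rewrite -(ycoord1_y (A j i) (B j i)) -lieE lieC lieE /ycoord1 linearN /=
    -/(ycoord1 _) ycoord1_y.
by rewrite -(ycoord2_y (A j i) (B j i)) -lieE lieC lieE /ycoord2 linearN /=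
  -/(ycoord2 _) ycoord2_y.
Qed.

Definition der_row1 (D : 'End(g)) : 'rV[K]_n := \row_i ycoord1 (D (tnth x i)).
Definition der_row2 (D : 'End(g)) : 'rV[K]_n := \row_i ycoord2 (D (tnth x i)).

Lemma der_row1_lin b (D D' : 'End(g)) : der_row1 (b *: D + D') = b *: der_row1
  D + der_row1 D'.
Proof. by apply/rowP => i; rewrite !mxE lfunE /= lfunE /= /ycoord1 linearP. Qed.

Lemma der_row2_lin b (D D' : 'End(g)) : der_row2 (b *: D + D') = b *: der_row2
  D + der_row2 D'.
Proof. by apply/rowP => i; rewrite !mxE lfunE /= lfunE /= /ycoord2 linearP. Qed.

Definition descends (D : 'End(g)) :=
  (forall v, D v \in derived_algebra g) /\
  (forall w, w \in derived_algebra g -> D w = 0).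

Lemma descendsE D v : descends D ->
  D v = (der_row1 D *m (xcoord v)^T) 0 0 *: y1 + (der_row2 D *m (xcoord v)^T) 0
    0 *: y2.
Proof.
move=> [D_der D0]; rewrite {1}(coord_decomp v) linearD /= (D0 _ (y_derived _
  _)) addr0.
rewrite linear_sum !mxE !scaler_suml -big_split; apply: eq_bigr => i _ /=.
rewrite linearZ /= {1}(derivedP (D_der _)) scalerDr !scalerA !mxE.
by congr (_ *: _ + _ *: _); rewrite mulrC.
Qed.

Lemma almost_inner_descends D : almost_inner D -> descends D.
Proof.
move=> [_ Dy]; split=> [v|w wW]; first by have [y ->] := Dy v; apply: lie_derived.
by have [y ->] := Dy w; apply: lie_central.
Qed.

Lemma almost_inner_rows D s t : almost_inner D ->
  ((s *: der_row1 D + t *: der_row2 D)%R <= (s *: A + t *: B)%R)%MS.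
Proof.
move=> aiD; have D_desc := almost_inner_descends aiD; have [_ Dy] := aiD.
apply: submx_colP => z Cz; pose v := xcomb z^T.
have xv : (xcoord v)^T = z by rewrite xcoord_xcomb trmxK.
have [y Dv] := Dy v; have Dv' := descendsE v D_desc.
rewrite Dv lie_coord xv in Dv'.
have E1 := congr1 ycoord1 Dv'; have E2 := congr1 ycoord2 Dv'.
rewrite !ycoord1_y in E1; rewrite !ycoord2_y in E2.
apply/rowP => i; rewrite ord1 mulmxDl -!scalemxAl mxE [X in X + _]mxE [X in _ +
  X]mxE -E1 -E2.
have := congr1 (fun M => (xcoord y *m M) 0 0) Cz.
rewrite mulmxDl mulmxDr -!scalemxAl -!scalemxAr !mulmxA mulmx0.
by rewrite mxE [X in X + _]mxE [X in _ + X]mxE.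
Qed.

Definition der_of_rows (d1 d2 : 'rV[K]_n) : 'End(g) :=
  linfun (fun v => (d1 *m (xcoord v)^T) 0 0 *: y1 + (d2 *m (xcoord v)^T) 0 0 *: y2).

Lemma der_of_rowsE d1 d2 v : der_of_rows d1 d2 v
  = (d1 *m (xcoord v)^T) 0 0 *: y1 + (d2 *m (xcoord v)^T) 0 0 *: y2.
Proof.
have xlin b u w : xcoord (b *: u + w) = b *: xcoord u + xcoord w.
  by apply/rowP => i; rewrite !mxE linearP.
pose f v := (d1 *m (xcoord v)^T) 0 0 *: y1 + (d2 *m (xcoord v)^T) 0 0 *: y2.
have f_lin : linear f.
  have entry d b u w : (d *m (xcoord (b *: u + w))^T) 0 0
      = b * (d *m (xcoord u)^T) 0 0 + (d *m (xcoord w)^T) 0 0.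
    by rewrite xlin linearP mulmxDr -scalemxAr mxE [X in X + _]mxE.
  by move=> b u w; rewrite /f !entry !scalerDl scalerDr !scalerA addrACA.
pose flin := GRing.isLinear.Build _ _ _ _ f f_lin.
pose fL : {linear g -> g} := HB.pack f flin.
exact: (lfunE fL).
Qed.

Lemma der_of_rows_rows d1 d2 :
  der_row1 (der_of_rows d1 d2) = d1 /\ der_row2 (der_of_rows d1 d2) = d2.
Proof.
split; apply/rowP => i; rewrite mxE der_of_rowsE xcoordx.
  by rewrite ycoord1_y trmx_delta -colE mxE.
by rewrite ycoord2_y trmx_delta -colE mxE.
Qed.

(** For fixed v the bracket with v has rank at most 2 as a map to the derived
    algebra; the functionals killing its image are the (s, t) with
    (s A + t B) v = 0, and the hypothesis says that they kill D v. *)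
Lemma der_of_rows_almost_inner d1 d2 :
  (forall s t, ((s *: d1 + t *: d2)%R <= (s *: A + t *: B)%R)%MS) ->
  almost_inner (der_of_rows d1 d2).
Proof.
move=> dAB; have xcoord0 w : w \in derived_algebra g -> xcoord w = 0.
  by move/derivedP => ->; rewrite xcoord_y.
have DW w : w \in derived_algebra g -> der_of_rows d1 d2 w = 0.
  by move=> wW; rewrite der_of_rowsE xcoord0 // trmx0 !mulmx0 !mxE !scale0r addr0.
split=> [u v|v].
  rewrite DW ?lie_derived // lieC !der_of_rowsE !(lie_central _ (y_derived _ _)).
  by rewrite oppr0 addr0.
pose z := (xcoord v)^T.
have : (row_mx (d1 *m z) (d2 *m z) <= row_mx (A *m z) (B *m z))%MS.
  apply: submx_colP => w; rewrite -[w]vsubmxK.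
  move: (usubmx w) (dsubmx w) => s t.
  rewrite (mx11_scalar s) (mx11_scalar t) !mul_row_col !mul_mx_scalar => Cz.
  have /submxP [y yE] := dAB (s 0 0) (t 0 0).
  rewrite !scalemxAl -mulmxDl yE -mulmxA mulmxDl -!scalemxAl Cz.
  by rewrite mulmx0.
move=> /submxP [a]; rewrite mul_mx_row => /eq_row_mx [E1 E2].
exists (xcomb a); rewrite der_of_rowsE -/z E1 E2 lie_coord xcoord_xcomb -/z.
by rewrite !mulmxA.
Qed.

Lemma inner_rows (y : g) (D : 'End(g)) : (forall v, D v = lie y v) ->
  der_row1 D = xcoord y *m A /\ der_row2 D = xcoord y *m B.
Proof.
move=> DE; split; apply/rowP => i; rewrite mxE DE lie_coord xcoordx trmx_delta.
  by rewrite ycoord1_y -colE [LHS]mxE.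
by rewrite ycoord2_y -colE [LHS]mxE.
Qed.

Lemma ad_exists (y : g) : exists2 D : 'End(g), D \in Inn g & forall v, D v =
  lie y v.
Proof.
exists (linfun (lie y)); last by move=> v; rewrite lfunE.
by apply/InnP; exists y => v; rewrite lfunE.
Qed.

Lemma inner_almost_inner (D : 'End(g)) : inner D -> almost_inner D.
Proof.
move=> [y DE]; split=> [u v|v]; last by exists y; rewrite DE.
rewrite !DE (lie_central y (lie_derived _ _)) [lie (lie _ _) _]lieC.
by rewrite (lie_central v (lie_derived _ _)) (lie_central u (lie_derived _ _))
  oppr0 addr0.
Qed.

Variable c : K.
Local Notation B' := (B + c *: A).

(** The second row is adapted to the change of B into B + c A. *)
Definition der_poly (D : 'End(g)) : 'rV[{poly K}]_n :=
  map_mx polyC (der_row1 D) + 'X *: map_mx polyC (der_row2 D + c *: der_row1 D).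

Lemma der_poly_lin b (D D' : 'End(g)) :
  der_poly (b *: D + D') = b%:P *: der_poly D + der_poly D'.
Proof.
rewrite /der_poly der_row1_lin der_row2_lin.
apply/rowP => i; rewrite !mxE !(polyCD, polyCM); ring.
Qed.

Lemma coef_der_poly D : coef_mx 0 (der_poly D) = der_row1 D /\
  coef_mx 1 (der_poly D) = der_row2 D + c *: der_row1 D.
Proof.
by split; apply/rowP => i; rewrite !mxE coefD coefXM !coefC /= ?addr0 ?add0r.
Qed.

Lemma der_poly_inj D : D \in AID g -> der_poly D = 0 -> D = 0.
Proof.
move=> /AIDP /almost_inner_descends D_desc D0.
have [E1 E2] := coef_der_poly D; rewrite D0 in E1 E2.
have d1 : der_row1 D = 0 by rewrite -E1; apply/rowP => i; rewrite !mxE coef0.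
have d2 : der_row2 D = 0.
  by move: E2; rewrite d1 scaler0 addr0 => <-; apply/rowP => i; rewrite !mxE coef0.
apply/lfunP => v; rewrite (descendsE v D_desc) d1 d2 !mul0mx lfunE /=.
by rewrite mxE !scale0r addr0.
Qed.

(** Inner derivations are the rows y M with y constant. *)
Lemma polydim_Inn s : polydim (row_sol A B' 1) s -> n = (s + \dim (Inn g))%N.
Proof.
move=> dim_s; have dim_n := polydim_box K (fun _ : 'I_n => 1%N).
rewrite -[n]muln1 -{1}[n]card_ord -sum_nat_const.
have sol_ext z : row_sol A B' 1 z <->
    (forall i, (size (z ord0 i) <= 1)%N) /\ z *m lpencil A B' = 0.
  by rewrite /row_sol; split=> -[].
apply: (polydim_rank_nullity dim_n (polydim_ext sol_ext dim_s)).
have := @polydim_vspace _ n _ (Inn g) der_poly => dimI.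
apply: polydim_ext (dimI _ _) => [z|b D D'|D /InnP innD]; last 2 first.
- exact: der_poly_lin.
- by apply: der_poly_inj; apply/AIDP/inner_almost_inner.
split=> [[D /InnP [y DE] ->]|[w size_w ->]].
  exists (map_mx polyC (xcoord y)) => [i|]; first by rewrite mxE size_polyC_leq1.
  rewrite mulC_lpencil /der_poly; have [-> ->] := inner_rows DE.
  by rewrite mulmxDr -scalemxAr.
have wE : w = map_mx polyC (coef_mx 0 w).
  by apply/rowP => i; rewrite !mxE; apply: size1_polyC.
have [D D_inn DE] := ad_exists (xcomb (coef_mx 0 w)); exists D => //.
rewrite wE mulC_lpencil /der_poly; have [-> ->] := inner_rows DE.
by rewrite xcoord_xcomb mulmxDr -scalemxAr.
Qed.

End LieCoordinates.

Section AlmostInner.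
Local Open Scope ring_scope.
Variables (R : rcfType) (g : lieAlgType R) (n : nat) (x : n.-tuple g) (y1 y2 : g).
Variables (A B : 'M[R]_n) (c : R).
Hypotheses (two_step : two_step_nilpotent g) (AB : associated_matrices x y1 y2 A B).
Local Notation B' := (B + c *: A).

(** The hypothesis is the condition at infinity, needed for the (s, t) with
    s = t c, which no finite value of the parameter reaches. *)
Lemma polydim_AID :
  (forall z, pointwise_image A B' 2 z -> (coef_mx 1 z <= B')%MS) ->
  polydim (pointwise_image A B' 2) (\dim (AID g)).
Proof.
move=> top; have := @polydim_vspace _ n _ (AID g) (der_poly x y1 y2 c) => dimA.
apply: polydim_ext (dimA _ _) => [z|b D D'|D D_aid]; last 2 first.
- exact: der_poly_lin.
- exact: (der_poly_inj two_step AB D_aid).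
split=> [[D /AIDP aiD ->]|zP].
  split=> [i|t].
    rewrite !mxE; apply: leq_trans (size_polyD _ _) _.
    rewrite geq_max (leq_trans (size_polyC_leq1 _)) //= mulrC mul_polyC.
    by apply: leq_trans (size_scale_leq _ _) _; rewrite size_polyX.
  have -> : map_mx (horner_eval t) (der_poly x y1 y2 c D)
      = (1 + t * c) *: der_row1 x y1 y2 D + t *: der_row2 x y1 y2 D.
    by apply/rowP => i; rewrite !mxE /horner_eval !hornerE; ring.
  have -> : A + t *: B' = (1 + t * c) *: A + t *: B.
    by apply/matrixP => i j; rewrite !mxE; ring.
  exact: (almost_inner_rows two_step AB).
pose z0 := coef_mx 0 z; pose z1 := coef_mx 1 z.
have zE : z = map_mx polyC z0 + 'X *: map_mx polyC z1.
  apply/rowP => i; apply/polyP => k; rewrite !mxE coefD coefC coefXM coefC.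
  case: k => [|[|k]] /=; rewrite ?addr0 ?add0r //.
  by apply: nth_default; apply: leq_trans (proj1 zP i) _.
(* undo the change of B into B + c A *)
pose D := der_of_rows x y1 y2 z0 (z1 - c *: z0); exists D.
  apply/AIDP/(der_of_rows_almost_inner two_step AB) => s t.
  have -> : s *: z0 + t *: (z1 - c *: z0) = (s - t * c) *: z0 + t *: z1.
    by apply/rowP => i; rewrite !mxE; ring.
  have -> : s *: A + t *: B = (s - t * c) *: A + t *: B'.
    by apply/matrixP => i j; rewrite !mxE; ring.
  have [->|u_n0] := eqVneq (s - t * c) 0.
    rewrite !scale0r !add0r; have [->|t_n0] := eqVneq t 0;
      first by rewrite !scale0r sub0mx.
    by rewrite !(eqmx_scale _ t_n0) top.
  set u := s - t * c; have tE : t = u * (t / u) by rewrite mulrC divfK.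
  rewrite tE -[_ *: z1]scalerA -[_ *: B']scalerA -!scalerDr !(eqmx_scale _ u_n0).
  have := proj2 zP (t / u); rewrite {1}zE; congr (_ <= _)%MS.
  by apply/rowP => i; rewrite !mxE /horner_eval !hornerE.
have [E1 E2] := der_of_rows_rows AB z0 (z1 - c *: z0).
by rewrite /der_poly E1 E2 subrK -zE.
Qed.

End AlmostInner.

(** * The dimension formula *)

Section MinimalIndices.
Local Open Scope ring_scope.
Variables (K : fieldType) (n : nat) (A B : 'M[K]_n).

Lemma row_sol_regular d z : \det (pencil A B) != 0 -> row_sol A B d z -> z = 0.
Proof.
move=> det_n0 [zM _]; have detM_n0 : \det (lpencil A B) != 0.
  apply: contra_neq det_n0 => detM0.
  rewrite -[pencil A B](mxsub_id) (minor_homog 0) scale0r addr0 mxsub_id detM0.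
  by rewrite /homog big1 // => i _; rewrite coef0 rmorph0 !mul0r.
have : z *m lpencil A B *m \adj (lpencil A B) = 0 by rewrite zM mul0mx.
rewrite -mulmxA mul_mx_adj mul_mx_scalar => /eqP.
by rewrite scalemx_eq0 (negPf detM_n0) => /eqP.
Qed.

Lemma polydim_minimal_indices eps d :
  A^T = - A -> B^T = - B -> minimal_indices A B eps ->
  polydim (row_sol A B d) (\sum_(e <- eps) (d - e)).
Proof.
move=> skewA skewB; rewrite /minimal_indices.
case: ifP => [_ [X minX ->]|/negbT det_n0 ->]; first exact: polydim_row_sol.
rewrite big_nil; exists 0 => [v _|z]; first by apply/rowP => -[].
split=> [zsol|[v ->]]; last by rewrite mulmx0; split=> [|i];
  rewrite ?mul0mx // mxE size_poly0.
by exists 0; rewrite (row_sol_regular det_n0 zsol) mulmx0.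
Qed.

End MinimalIndices.

Section GenericChart.
Local Open Scope ring_scope.

(** The rank is maximal outside the zeros of a nonzero polynomial in c; [good]
    collects the other values to be avoided. *)
Lemma generic_chart (R : numFieldType) n (A B : 'M[R]_n) (good : {poly R}) :
  good != 0 -> exists2 c, good.[c] != 0 &
    forall c', (\rank (B + c' *: A)%R <= \rank (B + c *: A)%R)%N.
Proof.
move=> good_n0; pose P m := `[< exists c, \rank (B + c *: A)%R = m >].
have exP : exists m, P m by exists (\rank (B + 0 *: A)%R); apply/asboolP; exists 0.
have ubP m : P m -> (m <= n)%N by move=> /asboolP [c <-]; apply: rank_leq_row.
have [m /asboolP [c1 c1m] mmax] := ex_maxnP exP ubP.
have [L [N LN]] := rank_witness (B + c1 *: A).
pose f := \det (map_mx polyC L *m lpencil B A *m map_mx polyC N).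
have fE c : f.[c] = \det (L *m (B + c *: A) *m N).
  rewrite /f -[_.[c]]/(horner_eval c _) -det_map_mx !map_mxM !eval_polyC.
  by rewrite eval_lpencil.
have f_n0 : f != 0.
  have f1 : f.[c1] = 1 by rewrite fE LN det1.
  by apply/eqP => f0; move/eqP: f1; rewrite f0 horner0 eq_sym oner_eq0.
have [c] := exists_nonroot (mulf_neq0 f_n0 good_n0).
rewrite hornerM mulf_eq0 negb_or => /andP [fc goodc]; exists c => // c'.
apply: (@leq_trans m); first by apply: mmax; apply/asboolP; exists c'.
move: fc; rewrite fE -unitfE -unitmxE -row_free_unit => /eqP.
rewrite -c1m => <-; apply: leq_trans (mxrankM_maxl _ _) (mxrankM_maxr _ _).
Qed.

End GenericChart.

Section GenericRank.
Local Open Scope ring_scope.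
Variables (R : rcfType) (n : nat) (A B : 'M[R]_n) (c : R).
Variables (U V : 'M[{poly R}]_n) (d : 'rV[{poly R}]_n) (r : nat).
Hypotheses (unitU : U \in unitmx) (unitV : V \in unitmx).
Hypothesis smith : lpencil A (B + c *: A) = U *m diag_mx d *m V.
Hypotheses (le_rn : (r <= n)%N) (rank_d : forall i : 'I_n, (d 0 i != 0) = (i <
  r)%N).
Hypothesis c_max : forall c', (\rank (B + c' *: A)%R <= \rank (B + c *: A)%R)%N.

(** The leading coefficient of the pencil has rank at most r by [rank_top_le].
    Conversely A + x (B + c A) has rank r for some nonzero x, and it is
    proportional to B + (c + 1/x) A, so the maximality of c applies. *)
Lemma rank_generic_chart : \rank (B + c *: A)%R = r.
Proof.
apply/eqP; rewrite eqn_leq; apply/andP; split.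
  have size_M i j : (size (lpencil A (B + c *: A) i j) <= 2)%N.
    apply: (proj2 (size_mx_leP 2 _)) => k le_k.
    by rewrite coef_lpencil !ifN //; lia.
  have := rank_top_le (r := r) size_M; rewrite coef_lpencil /=; apply=> x.
  by rewrite eval_lpencil; apply: (rank_eval_le unitU unitV smith le_rn rank_d).
have X_n0 : 'X != 0 :> {poly R} by rewrite polyX_eq0.
have [x] := exists_nonroot (mulf_neq0 (chain_prod_neq0 rank_d (leqnn r)) X_n0).
rewrite hornerM hornerX mulf_eq0 negb_or => /andP [dx x_n0].
suff <- : \rank (A + x *: (B + c *: A))%R = r.
  have -> : A + x *: (B + c *: A) = x *: (B + (c + x^-1) *: A).
    rewrite !scalerDr scalerA [in RHS]scalerA mulrDr divff // scalerDl scale1r.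
    by rewrite addrC addrA.
  by rewrite mxrank_scale_nz.
rewrite -eval_lpencil smith !map_mxM mxrank_equiv ?map_unitmx_rmorph // map_diag_mx.
apply: mxrank_diag => // i; rewrite mxE /= /horner_eval.
have [lt_i|le_i] := ltnP i r.
  move: dx; rewrite /chain_prod horner_prod => /prodf_neq0 /(_ i lt_i).
  by [].
have : d 0 i == 0 by rewrite -[_ == 0]negbK rank_d -leqNgt.
by move=> /eqP ->; rewrite horner0 eqxx.
Qed.

End GenericRank.

Lemma sum_eps (eps : seq nat) :
  (\sum_(e <- eps) e + \sum_(e <- eps) (1 - e) = \sum_(d <- eps | d != 0) (d -
    1) + size eps)%N.
Proof.
elim: eps => [|e eps IHe]; first by rewrite !big_nil.
by rewrite !big_cons; case: e => [|e] /=; lia.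
Qed.

Lemma sum_subn (eps : seq nat) k : (\sum_(e <- eps) e <= k)%N ->
  (\sum_(e <- eps) (k - e) + \sum_(e <- eps) e = size eps * k)%N.
Proof.
elim: eps => [|e eps IHe]; first by rewrite !big_nil.
rewrite !big_cons /= mulSn => le_k; have := IHe; lia.
Qed.

Theorem theorem5p11 (R : realType) (g : lieAlgType R)
    (n : nat) (x : n.-tuple g) (y1 y2 : g) (A B : 'M[R]_n)
    (eps : seq nat) (es : seq nat)
    (fs : seq (R * nat)) (ms : seq (complex R * nat)) :
  two_step_nilpotent g -> genus2 g ->
  associated_matrices x y1 y2 A B ->
  minimal_indices A B eps ->
  elementary_divisor_pairs A B es fs ms ->
  \dim (AID g) =
    (\dim (Inn g) + \sum_(d <- eps | d != 0) (d - 1)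
     + 2 * \sum_(e <- es) (e - 1)
     + 2 * \sum_(q <- fs) (q.2 - 1)
     + 4 * \sum_(q <- ms) q.2)%N.
Proof.
move=> two_step _ AB min_eps elem.
have [skewA skewB] := associated_skew AB.
(* c <> 0 and 1 - c alpha <> 0: the point dropped by the affine coordinate is
   not a zero of mu nor of lambda - alpha mu. *)
pose good : {poly R} := ('X * \prod_(q <- fs) (1 - q.1 *: 'X))%R.
have good_n0 : good != 0%R.
  rewrite mulf_neq0 ?polyX_eq0 // prodf_seq_neq0; apply/allP => q _ /=.
  apply/eqP => /(congr1 (fun p : {poly R} => p.[0]%R)).
  by rewrite !hornerE ?mulr0 ?subr0 => /eqP; rewrite oner_eq0.
have [c] := generic_chart A B good_n0.
rewrite hornerM hornerX mulf_eq0 negb_or => /andP [c_n0 c_fs] c_max.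
have {}c_fs q : q \in fs -> (1 - c * q.1 != 0)%R.
  move=> q_fs; move: c_fs; rewrite horner_prod prodf_seq_neq0 => /allP /(_ q q_fs).
  by rewrite !hornerE mulrC.
have [U [V [d [unitU unitV smith d_chain]]]] := smith_form (lpencil A (B + c *:
  A)%R).
have [r le_rn rank_d] := dvd_chain_rank d_chain.
have rankB := rank_generic_chart unitU unitV smith le_rn rank_d c_max.
have dim_sol k := row_sol_chart c (polydim_minimal_indices k skewA skewB min_eps).
have dim_AID := polydim_AID two_step AB (fun z => @pointwise_image_top _ _ _ _
  _ _ _ _ unitU unitV smith le_rn rank_d rankB 0 z).
have dim_Inn := polydim_Inn two_step AB (dim_sol 1%N).
have [N count] := pointwise_image_count unitU unitV smith le_rn rank_d rankB
  dim_AID.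
have rank_pencil := rank_frac_pencil unitU unitV smith le_rn rank_d.
have excess := sum_invariant_excess c_n0 le_rn rank_pencil
  (fun i_ i lt_i => dehomog_invariant_factor unitU unitV d_chain smith le_rn
    rank_d lt_i) elem c_fs.
have sum_d : (\sum_i root_excess (d ord0 i) = 2 * half_weight es fs ms)%N.
  rewrite -excess [RHS]big_mkcond; apply: eq_bigr => i _; case: ifP => // /negbT.
  by rewrite -rank_d negbK => /eqP ->; rewrite /root_excess size_poly0.
rewrite sum_d in count.
(* beyond the sum of the eps no subtraction is truncated *)
pose k := (N + \sum_(e <- eps) e)%N.
(* the count at k and k + 1 determines the rank r *)
have count1 := count k (leq_addr _ _) _ (dim_sol _).
have count2 := count k.+1 (leqW (leq_addr _ _)) _ (dim_sol _).
have sub1 := @sum_subn eps k.+1 (leqW (leq_addl _ _)).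
have sub2 := @sum_subn eps k.+2 (leqW (leqW (leq_addl _ _))).
have eps_eq := sum_eps eps.
have weight : (2 * half_weight es fs ms = 2 * \sum_(e <- es) (e - 1)
   + 2 * \sum_(q <- fs) (q.2 - 1) + 4 * \sum_(q <- ms) q.2)%N.
  have -> : half_weight es fs ms = (\sum_(e <- es) (e - 1)
     + \sum_(q <- fs) (q.2 - 1) + 2 * \sum_(q <- ms) q.2)%N.
    by rewrite /half_weight big_distrr.
  by rewrite mulnDr mulnDr [in RHS](_ : 4 = 2 * 2)%N // -[in RHS]mulnA.
rewrite weight in count1 count2.
move: dim_Inn count1 count2 sub1 sub2 eps_eq.
move: (\dim (Inn g)) (\dim (AID g)) k => I a k.
move: (\sum_(e <- es) _)%N (\sum_(q <- fs) _)%N (\sum_(q <- ms) _)%N => E1 E2 E3.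
move: (\sum_(e <- eps) (1 - e))%N (\sum_(e <- eps) (k.+1 - e))%N (\sum_(e <-
  eps) (k.+2 - e))%N => s0 s1 s2.
move: (\sum_(e <- eps) e)%N (\sum_(d <- eps | d != 0) (d - 1))%N (size eps) =>
  S E0 m.
rewrite !mulnS !mulSn; lia.
Qed.
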